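(* Let $H$, $G$ be Hilbert spaces and let $A:D(A)\subset H\to H$ be a positive self-adjoint operator with compact resolvent such that, for some $\omega>0$, $|Au|\ge \omega|u|$ for all $u\in D(A)$. Let $\mathbf B^{*}\in\mathcal L(H_2\times H;G)$ be such that for all $T>0$ there is $C>0$ such that for all $(w^0,w^1)\in H_1\times H$ and all $f\in L^2([0,T];H)$ the solution $w$ of $w''+Aw=f$, $(w,w')(0)=(w^0,w^1)$ satisfies, with $W=(w,w')$, $$\int_0^T\|\mathbf B^{*}(w,w')\|_G^2dt\le C\Big(e_1(W)(0)+e_1(W)(T)+\int_0^Te_1(W)(t)dt+\int_0^T|f|^2dt\Big).$$ Let $C_{21}$ be a bounded operator on $H$ such that $C_{21}^{*}\in\mathcal L(H_k)$ for $k\in\{0,1\}$, $\|C_{21}\|=\beta$ and $|C_{21}w|^2\le\beta\langle C_{21}w,w\rangle$ for all $w\in H$. Assume that at least one of the following two properties fails: (a) there is $T_0>0$ such that for all $T>T_0$ there is $C_2(T)>0$ such that for all $(w^0,w^1)\in H_1\times H$ the solution of $w''+Aw=0$, $(w,w')(0)=(w^0,w^1)$ satisfies $\int_0^T|C_{21}w'|^2dt\ge C_2(T)\,e_1(W)(0)$; (b) there is $T_0>0$ such that for all $T>T_0$ there is $C_1(T)>0$ such that for all $(w^0,w^1)\in H_1\times H$ the solution of $w''+Aw=0$, $(w,w')(0)=(w^0,w^1)$ satisfies $\int_0^T\|\mathbf B^{*}(w,w')\|_G^2dt\ge C_1(T)\,e_1(W)(0)$. Then there does not exist $T_3>0$ such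 that for all $T>T_3$ the following holds: there exists $C>0$ such that for all $U^0=(u_1^0,u_2^0,u_1^1,u_2^1)\in \mathcal H=H_1^2\times H^2$ the solution of $$u_1''+Au_1=0,\qquad u_2''+Au_2+C_{21}u_1=0,\qquad (u_i,u_i')(0)=(u_i^0,u_i^1)\ (i=1,2)$$ satisfies $$C\big(e_0(U_1)(0)+e_1(U_2)(0)\big)\le\int_0^T\|\mathbf B^{*}U_2\|_G^2\,dt .$$
   Context: $H$ has norm $|\cdot|$ and scalar product $\langle\cdot,\cdot\rangle$; $G$ has norm $\|\cdot\|_G$ and is identified with its dual. For $k\in\mathbb N$, $H_k=D(A^{k/2})$ (with $H_0=H$) has norm $|A^{k/2}u|$; $H_{-k}$ is the dual of $H_k$ with pivot space $H$, with norm $|A^{-k/2}u|$. For $k\in\mathbb Z$ and a function $V=(v_1,v_2)$ of time with values in $H_k\times H_{k-1}$, $e_k(V)(t)=\frac12\big(|A^{k/2}v_1(t)|^2+|A^{(k-1)/2}v_2(t)|^2\big)$. $W=(w,w')$ and, for a solution $(u_1,u_2)$ of the coupled system, $U_i=(u_i,u_i')$; the prime is the time derivative. For finite-energy solutions, $\mathbf B^{*}(w,w')\in L^2([0,T];G)$ is understood as the extension by continuity from regular data permitted by the admissibility inequality. *)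

(* Defs.v *)
From HB Require Import structures.
From mathcomp Require Import all_boot all_order all_algebra.
From mathcomp Require Import all_classical all_reals all_analysis.

Set Implicit Arguments.
Unset Strict Implicit.
Unset Printing Implicit Defensive.

Import Order.TTheory GRing.Theory Num.Theory.
Import numFieldNormedType.Exports.

Local Open Scope classical_set_scope.
Local Open Scope ring_scope.

(* Real Hilbert spaces; a complex one is covered by restriction of scalars,
   with the real part of its scalar product. *)
HB.mixin Record CompleteNormedModule_isHilbert (R : realType) H
    of CompleteNormedModule R H := {
  ip : {dot H for (idfun : R -> R)};
  ip_norm : forall x : H, (ip x x : R) = `|x| ^+ 2 }.

#[short(type="hilbertType")]
HB.structure Definition Hilbert (R : realType) :=
  {H of CompleteNormedModule_isHilbert R H & CompleteNormedModule R H}.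

Section operators.
Context {R : realType} {H : hilbertType R}.

(* An operator in H with domain D is given by D and a total function whose
   values outside D are irrelevant. *)
Record operator := Operator {
  dom : set H;
  app :> H -> H;
  dom0 : dom 0;
  dom_lin : forall (a : R) u v, dom u -> dom v -> dom (a *: u + v);
  app_lin : forall (a : R) u v, dom u -> dom v ->
    app (a *: u + v) = a *: app u + app v }.

(* dense domain, and equality of the graphs of T and of its adjoint *)
Definition self_adjoint (T : operator) :=
  closure (dom T) = setT /\
  forall x z, (dom T x /\ T x = z) <->
              (forall y, dom T y -> ip (T y) x = ip y z).

Definition positive_op (T : operator) :=
  forall u, dom T u -> 0 <= ip (T u) u :> R.

Definition compact_op (K : H -> H) :=
  compact (closure (K @` [set x | `|x| <= 1])).

Definition is_resolvent (T : operator) (lambda : R) (K : {linear H -> H}) :=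
  [/\ continuous K,
      forall y, dom T (K y) /\ T (K y) - lambda *: K y = y &
      forall u, dom T u -> K (T u - lambda *: u) = u].

Definition compact_resolvent (T : operator) :=
  exists (lambda : R) (K : {linear H -> H}),
    is_resolvent T lambda K /\ compact_op K.

(* S = T^{1/2}: the positive self-adjoint S with S o S = T, domains included *)
Definition is_sqrt (S T : operator) :=
  [/\ self_adjoint S, positive_op S,
      dom T = [set u | dom S u /\ dom S (S u)] &
      forall u, dom T u -> T u = S (S u)].

Definition inv_op (S : operator) (y : H) : H :=
  xget 0 [set x | dom S x /\ S x = y].

(* In the following, S stands for A^{1/2}. *)

(* A^{k/2}; for k < 0 this is the bounded operator on H, the elements of
   H_{-k} outside H being not represented *)
Definition hpow (S : operator) (k : int) : H -> H :=
  match k with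
  | Posz n => iter n S
  | Negz n => iter n.+1 (inv_op S)
  end.

(* H_k = D(A^{k/2}) *)
Definition Hk (S : operator) (k : nat) : set H :=
  [set u | forall j, (j < k)%N -> dom S (iter j S u)].

Definition energy (S : operator) (k : int) (V : R -> H * H) (t : R) : R :=
  2^-1 * (`|hpow S k (V t).1| ^+ 2 + `|hpow S (k - 1) (V t).2| ^+ 2).

Definition opnorm (L : H -> H) : R := sup [set `|L x| | x in [set x | `|x| <= 1]].

Definition adjoint (L : H -> H) (y : H) : H :=
  xget 0 [set z | forall x, ip (L x) y = ip x z].

(* L \in L(H_k) *)
Definition bounded_on_Hk (S : operator) (k : nat) (L : H -> H) :=
  [/\ forall u, Hk S k u -> Hk S k (L u),
      forall (a : R) u v, Hk S k u -> Hk S k v -> L (a *: u + v) = a *: L u + L v &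
      exists M : R, forall u, Hk S k u -> `|hpow S k (L u)| <= M * `|hpow S k u| ].

End operators.

Arguments operator {R} H.

Section observation_operator.
Context {R : realType} {H G : hilbertType R}.

(* B \in L(H_2 x H; G); the values of B outside H_2 x H are irrelevant *)
Definition bounded_H2H (S : operator H) (B : H * H -> G) :=
  (forall (a : R) p q, Hk S 2 p.1 -> Hk S 2 q.1 ->
     B (a *: p.1 + q.1, a *: p.2 + q.2) = a *: B p + B q) /\
  exists M : R, forall p, Hk S 2 p.1 -> `|B p| <= M * (`|hpow S 2 p.1| + `|p.2|).

End observation_operator.

Section L2.
Context {R : realType} {V : completeNormedModType R}.
Local Notation mu := (@lebesgue_measure R).

Definition simple_fun (g : R -> V) :=
  finite_set (range g) /\ forall v, measurable (g @^-1` [set v]).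

Definition sqnorm_int (T : R) (g : R -> V) : \bar R :=
  (\int[mu]_(t in `[0%R, T]) (`|g t| ^+ 2)%:E)%E.

(* g is strongly measurable on [0,T] (every class in the Bochner space has a
   representative that is an everywhere limit of simple functions) and square
   integrable *)
Definition L2 (T : R) (g : R -> V) :=
  (exists s : nat -> R -> V, (forall n, simple_fun (s n)) /\
     forall t, t \in `[0, T] -> s n t @[n --> \oo] --> g t) /\
  (sqnorm_int T g < +oo)%E.

Definition cvgL2 (T : R) (gn : nat -> R -> V) (g : R -> V) :=
  sqnorm_int T (gn n \- g) @[n --> \oo] --> 0%E.

End L2.

Section wave.
Context {R : realType} {H G : hilbertType R}.
Variables (S : operator H).
Local Notation mu := (@lebesgue_measure R).

(* W = (w, w') where w \in C([0,T]; H_1) \cap C^1([0,T]; H) satisfies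
   w'' + A w = f and (w,w')(0) = p: the equation is integrated in time and
   tested against H_1, so that it holds in H_{-1} for almost every time. *)
Definition wave_solution (T : R) (f : R -> H) (p : H * H) (W : R -> H * H) :=
  [/\ [/\ forall t, t \in `[0, T] -> Hk S 1 (W t).1,
      {within `[0, T], continuous (fun t => S (W t).1)},
      {within `[0, T], continuous (fun t => (W t).1)},
      {within `[0, T], continuous (fun t => (W t).2)} &
      forall t : R, t \in `]0, T[ ->
        is_derive t (1 : R) (fun s : R => (W s).1) (W t).2],
      W 0 = p &
      forall phi, Hk S 1 phi -> forall t, t \in `[0, T] ->
        ip (W t).2 phi = ip p.2 phi +
          \int[mu]_(s in `[0, t]) (ip (f s) phi - ip (S (W s).1) (S phi)) ].

(* w \in C([0,T]; H_2) \cap C^1([0,T]; H_1) *)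
Definition regular (T : R) (W : R -> H * H) :=
  [/\ forall t, t \in `[0, T] -> Hk S 2 (W t).1,
      {within `[0, T], continuous (fun t => hpow S 2 (W t).1)},
      forall t, t \in `[0, T] -> Hk S 1 (W t).2,
      {within `[0, T], continuous (fun t => hpow S 1 (W t).2)} &
      forall t : R, t \in `]0, T[ ->
        is_derive t (1 : R) (fun s : R => S (W s).1) (S (W t).2)].

(* y = B(w,w') in L^2([0,T]; G), for the solution W = (w,w') with data (p, f):
   y is the limit of B(w_n,w_n') for regular solutions (w_n,w_n') whose data
   converge to (p, f) in H_1 x H x L^2([0,T]; H). *)
Definition observation (B : H * H -> G) (T : R) (f : R -> H) (p : H * H)
    (y : R -> G) :=
  L2 T y /\
  exists (pn : nat -> H * H) (fn : nat -> R -> H) (Wn : nat -> R -> H * H),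
  [/\ forall n, [/\ L2 T (fn n), wave_solution T (fn n) (pn n) (Wn n) &
                    regular T (Wn n)],
      S (pn n).1 @[n --> \oo] --> S p.1,
      (pn n).2 @[n --> \oo] --> p.2,
      cvgL2 T fn f &
      cvgL2 T (fun n t => B (Wn n t)) y].

End wave.

(* Main.v *)
Require Import Defs.
From HB Require Import structures.
From mathcomp Require Import all_boot all_order all_algebra.
From mathcomp Require Import all_classical all_reals all_analysis.
From mathcomp Require Import ring lra.

Set Implicit Arguments.
Unset Strict Implicit.
Unset Printing Implicit Defensive.

Import Order.TTheory GRing.Theory Num.Theory.
Import numFieldNormedType.Exports.

Local Open Scope classical_set_scope.
Local Open Scope ring_scope.

(* Observability of the coupled system is shown to imply both (a) and (b).
   (b) is the case u1 = 0. For (a), take u1 = w' and zero data for u2. If u1 is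
   a finite trigonometric sum of eigenvectors of S = A^{1/2}, then u2 is regular,
   so that its observation is B(u2, u2'), and the admissibility inequality with
   the energy estimate for u2 gives
     C e_1(W)(0) = C e_0(U1)(0) <= int |B U2|^2 <= C' int |C21 w'|^2.
   Eigenvectors are total since A has a compact resolvent, and w'(t) =
   cos(tS) w^1 - sin(tS) S w^0 depends on the data with norm at most one, for
   every weak solution w; density gives (a). The solution u2 for a source
   g(t) h, with h in H arbitrary, is y_t(S) h, where y_t(s) solves the scalar
   equation y'' + s^2 y = g; boundedness of s^2 y_t(s), uniformly in s, and
   pointwise convergence in s replace the spectral theorem. *)

(** With [u1 = w'] the data of [U1] are [(w^1, - A w^0)], and [A^{-1/2} A w^0 = S w^0]; this is why
    the weak energy e_0 of [U1] is exactly e_1 of [W]. The choice is not legitimate for every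
    finite-energy [w]: then [w'] lies only in H, while observability takes data of [u1] in H_1 x H.
    Hence trigonometric sums, followed by a limit that needs an error uniform in time. The obstacle
    is [u2]. Even when [u1] is a single mode, [C21 u1] is a scalar function of time times a general
    vector of H, so [u2] is not a finite sum and its source has no regularity in space. Regularity
    comes from time instead: the scalar factor has a bounded derivative, and this bounds s^2 y,
    which puts [u2] in D(A). Then B can be applied to [(u2, u2')] at each time, and the constant
    sequence witnesses the observation. No orthonormal basis is chosen: a vector phi(S) x is pinned
    down by its scalar products with all eigenvectors. *)

(** * Geometry of a real Hilbert space *)

Section inner_product.
Context {R : realType} {H : hilbertType R}.
Implicit Types x y z : H.

Lemma ipDl x y z : ip (x + y) z = ip x z + ip y z :> R.
Proof. exact: linearDl. Qed.

Lemma ipDr x y z : ip x (y + z) = ip x y + ip x z :> R.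
Proof. exact: linearDr. Qed.

Lemma ipZl (a : R) x y : ip (a *: x) y = a * ip x y.
Proof. exact: linearZl_LR. Qed.

Lemma ipC x y : ip x y = ip y x :> R.
Proof. by rewrite hermC /= expr0 mul1r. Qed.

Lemma ipZr (a : R) x y : ip x (a *: y) = a * ip x y.
Proof. by rewrite ipC ipZl ipC. Qed.

Lemma ip0l x : ip 0 x = 0 :> R.
Proof. by rewrite -(scale0r 0) ipZl mul0r. Qed.

Lemma ip0r x : ip x 0 = 0 :> R.
Proof. by rewrite ipC ip0l. Qed.

Lemma ipNl x y : ip (- x) y = - ip x y :> R.
Proof. by rewrite -scaleN1r ipZl mulN1r. Qed.

Lemma ipNr x y : ip x (- y) = - ip x y :> R.
Proof. by rewrite ipC ipNl ipC. Qed.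

Lemma ipBl x y z : ip (x - y) z = ip x z - ip y z :> R.
Proof. by rewrite ipDl ipNl. Qed.

Lemma ipBr x y z : ip x (y - z) = ip x y - ip x z :> R.
Proof. by rewrite ipDr ipNr. Qed.

Lemma ip_suml (I : Type) (s : seq I) (F : I -> H) y :
  ip (\sum_(i <- s) F i) y = \sum_(i <- s) ip (F i) y :> R.
Proof.
elim: s => [|a s IH]; first by rewrite !big_nil ip0l.
by rewrite !big_cons ipDl IH.
Qed.

Lemma ip_sumr (I : Type) (s : seq I) (F : I -> H) y :
  ip y (\sum_(i <- s) F i) = \sum_(i <- s) ip y (F i) :> R.
Proof. by rewrite ipC ip_suml; apply: eq_bigr => i _; rewrite ipC. Qed.

Lemma normD_sqr x y : `|x + y| ^+ 2 = `|x| ^+ 2 + 2 * ip x y + `|y| ^+ 2.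
Proof. rewrite -!ip_norm ipDl !ipDr (ipC y x) /=; ring. Qed.

Lemma normB_sqr x y : `|x - y| ^+ 2 = `|x| ^+ 2 - 2 * ip x y + `|y| ^+ 2.
Proof. by rewrite normD_sqr normrN ipNr mulrN. Qed.

Lemma sqr_norm_le2 x y : `|x| ^+ 2 <= 2 * `|y| ^+ 2 + 2 * `|x - y| ^+ 2.
Proof.
rewrite -{1}(subrK y x); move: (x - y) => z.
have := sqr_ge0 `|z - y|; rewrite (normB_sqr z y) (normD_sqr z y).
by set w : R := ip z y; lra.
Qed.

(** Polarization reduces joint continuity of the scalar product to continuity of the norm. *)
Lemma ip_cvg (T : Type) (F : set_system T) {FF : Filter F} (f g : T -> H) x y :
  f @ F --> x -> g @ F --> y -> (ip (f t) (g t) : R) @[t --> F] --> (ip x y : R).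
Proof.
move=> fx gy.
have polar (u v : H) : ip u v = 2^-1 * (`|u + v| ^+ 2 - `|u| ^+ 2 - `|v| ^+ 2) :> R.
  by rewrite normD_sqr; field.
under eq_fun do rewrite polar; rewrite polar.
have sq (h : T -> H) (z : H) : h @ F --> z -> `|h t| ^+ 2 @[t --> F] --> `|z| ^+ 2.
  by move=> hz; apply: cvgM; apply: cvg_norm.
apply: cvgMr; apply: cvgB; last exact: sq.
by apply: cvgB; [apply: (sq (fun t => f t + g t)); exact: cvgD|exact: sq].
Qed.

Lemma cvg_norm_harmonic (u : nat -> H) x :
  (forall n, `|x - u n| < n.+1%:R^-1) -> u @ \oo --> x.
Proof.
move=> ux; apply/cvgrPdist_lt => e e0.
near=> n; apply: lt_trans (ux n) _.
near: n; have := cvgr_lt _ (@cvg_harmonic R) _ e0; exact.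
Unshelve. all: by end_near. Qed.

(** The hypothesis has the shape in which the parallelogram law delivers a Cauchy estimate. *)
Lemma cauchy_sqr_cvg (u : nat -> H) (a : nat -> R) :
  a @ \oo --> 0 -> (forall n k, `|u n - u k| ^+ 2 <= a n + a k) ->
  exists z, u @ \oo --> z.
Proof.
move=> a0 ua; suff : cvgn u by move=> /cvg_ex[z uz]; exists z.
apply/cauchy_cvgP/cauchyP => e e0.
have e2 : 0 < e ^+ 2 / 2 by rewrite divr_gt0// exprn_gt0.
have [N _ aN] := cvgr_lt _ a0 _ e2.
exists (u N), N => // n /= Nn; rewrite -ball_normE /=.
rewrite -ltr_sqr ?nnegrE ?normr_ge0 ?(ltW e0)//.
apply: le_lt_trans (ua _ _) _.
by rewrite [ltRHS]splitr ltrD// aN//=.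
Qed.

(* Nearest-point argument: a minimizing sequence in M is Cauchy. *)
Lemma dense_of_orth (M : set H) : M 0 ->
  (forall (a : R) x y, M x -> M y -> M (a *: x + y)) ->
  (forall x, (forall m, M m -> (ip x m : R) = 0) -> x = 0) ->
  forall x (e : R), 0 < e -> exists2 m, M m & `|x - m| < e.
Proof.
move=> M0 Mlin Morth x e e0.
pose E := [set `|x - m| ^+ 2 | m in M].
have E_inf : has_inf E.
  by split; [exists (`|x - 0| ^+ 2), 0|exists 0 => _ [m _ <-]; exact: sqr_ge0].
pose d := inf E.
have dE m : M m -> d <= `|x - m| ^+ 2.
  by move=> Mm; apply: ge_inf; [case: E_inf|exists m].
have /choice[u uP] n : exists m, M m /\ `|x - m| ^+ 2 < d + n.+1%:R^-1.
  have n0 : (0 : R) < n.+1%:R^-1 by rewrite invr_gt0.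
  by have [_ [m Mm <-] md] := inf_adherent n0 E_inf; exists m.
have [z uz] : exists z, u @ \oo --> z.
  (* In the parallelogram identity for [x - u n] and [x - u k], the midpoint of [u n] and [u k] is
     in [M], hence at squared distance at least [d] from [x]. The terms in [d] cancel and twice the
     two errors remain. *)
  apply: (@cauchy_sqr_cvg _ (fun n => 2 * n.+1%:R^-1)).
    by rewrite -[X in _ --> X](mulr0 2); apply: cvgMr; exact: cvg_harmonic.
  move=> n k; have [[Mn un] [Mk uk]] := (uP n, uP k).
  have Mmid : M (2^-1 *: u n + 2^-1 *: u k).
    by apply: (Mlin) => //; rewrite -[_ *: _]addr0; exact: Mlin.
  have dm := dE _ Mmid.
  have e1 : u n - u k = (x - u k) - (x - u n).
    by rewrite opprB [RHS]addrC addrA subrK.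
  have e2 : x - (2^-1 *: u n + 2^-1 *: u k) = 2^-1 *: ((x - u k) + (x - u n)).
    have xE : x = 2^-1 *: (x + x).
      by rewrite -mulr2n -[x *+ 2]scaler_nat scalerA mulVf// scale1r.
    by rewrite {1}xE -scalerDr -scalerBr addrACA -opprD [u k + _]addrC.
  move: dm un uk; rewrite e1 (normB_sqr (x - u k)).
  rewrite e2 normrZ exprMn (normD_sqr (x - u k)) ger0_norm ?invr_ge0//.
  set b := n.+1%:R^-1; set c := k.+1%:R^-1; set w : R := ip _ _; lra.
suff zx : x - z = 0.
  have /cvgrPdist_lt/(_ e e0)[N _ /(_ N (leqnn N)) uN] := uz.
  exists (u N); first by have [] := uP N.
  by move/eqP: zx; rewrite subr_eq0 => /eqP ->.
apply: Morth => m Mm.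
(* [M] is not assumed closed, so [z] may lie outside it: minimality is tested at [u n + t *: m] and
   passed to the limit. *)
have key t : 0 <= - (2 * t * ip (x - z) m) + t ^+ 2 * `|m| ^+ 2.
  have : (fun n => - (2 * t * ip (x - u n) m) + t ^+ 2 * `|m| ^+ 2 + n.+1%:R^-1)
      @ \oo --> - (2 * t * ip (x - z) m) + t ^+ 2 * `|m| ^+ 2 + 0.
    apply: cvgD; last exact: cvg_harmonic.
    apply: cvgD; last exact: cvg_cst.
    apply: cvgN; apply: cvgMr; apply: ip_cvg; last exact: cvg_cst.
    by apply: cvgB => //; exact: cvg_cst.
  rewrite addr0 => h; apply: (ler_cvg_to (cvg_cst 0) h).
  apply: nearW => n; have [Mn un] := uP n.
  have dm : d <= `|x - (u n + t *: m)| ^+ 2.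
    by apply: dE; rewrite addrC; exact: Mlin.
  move: dm; rewrite opprD addrA (normB_sqr (x - u n)) ipZr normrZ exprMn.
  rewrite real_normK ?num_real//.
  move: un; set q := _^-1; lra.
have [->|m0] := eqVneq m 0; first by rewrite ip0r.
have nm : 0 < `|m| ^+ 2 by rewrite exprn_gt0// normr_gt0.
set q : R := ip _ _ in key *.
(* This [t] minimizes the quadratic; what remains is [- (q^2 / N) >= 0]. *)
have := key (q / `|m| ^+ 2); move: (`|m| ^+ 2) nm => N nm.
have -> : - (2 * (q / N) * q) + (q / N) ^+ 2 * N = - (q ^+ 2 / N).
  by field; rewrite gt_eqF.
rewrite oppr_ge0 pmulr_lle0 ?invr_gt0// => q0.
by apply/eqP; rewrite -sqrf_eq0 eq_le q0 sqr_ge0.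
Qed.

End inner_product.

(** * Eigenvectors of a compact symmetric operator *)

Section compact_symmetric.
Context {R : realType} {H : hilbertType R}.
Variables (K : {linear H -> H}) (M : set H).
Hypothesis K_cont : continuous K.
Hypothesis K_compact : compact_op K.
Hypothesis K_sym : forall x y, ip (K x) y = ip x (K y) :> R.
Hypothesis M_lin : forall (a : R) x y, M x -> M y -> M (a *: x + y).
Hypothesis M_closed : closed M.
Hypothesis MK : forall x, M x -> M (K x).

(** A maximizing sequence for |K x| on the unit ball of [M] almost solves K^2 z = k^2 z; compactness
    makes a selection of it converge, and K^2 - k^2 = (K - k)(K + k) gives an eigenvector for k or
    for -k. The invariant subspace [M] allows the use on the orthogonal complement of the known
    eigenvectors. *)
Lemma compact_symmetric_eigenvector x0 : M x0 -> K x0 != 0 ->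
  exists (kappa : R) y, [/\ kappa != 0, M y, y != 0 & K y = kappa *: y].
Proof.
move=> Mx0 Kx0.
have M0 : M 0 by rewrite -(addNr x0) -scaleN1r; exact: M_lin.
have MZ (a : R) x : M x -> M (a *: x).
  by move=> Mx; rewrite -[_ *: _]addr0; exact: M_lin.
have x0_neq0 : x0 != 0 by apply: contraNneq Kx0 => ->; rewrite linear0.
pose E := [set `|K x| | x in [set x | M x /\ `|x| <= 1]].
have E_sup : has_sup E.
  split; first by exists `|K 0|, 0 => //=; rewrite normr0.
  have [N [Nr NP]] := compact_bounded K_compact.
  exists (N + 1) => _ [x [Mx x1] <-]; apply: (NP (N + 1)) => //.
    by rewrite ltrDl.
  by apply: subset_closure; exists x.
pose k := sup E.
have Kk x : M x -> `|K x| <= k * `|x|.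
  move=> Mx; have [->|xn0] := eqVneq x 0.
    by rewrite linear0 !normr0 mulr0.
  have nx : 0 < `|x| by rewrite normr_gt0.
  rewrite -ler_pdivrMr//; apply: (@sup_upper_bound R _ E_sup).
  exists (`|x|^-1 *: x); last first.
    by rewrite linearZ normrZ normfV normr_id mulrC.
  by split; [exact: MZ|rewrite normrZ normfV normr_id mulVf// gt_eqF].
have k0 : 0 < k.
  have : 0 < k * `|x0| by apply: lt_le_trans (Kk _ Mx0); rewrite normr_gt0.
  by rewrite pmulr_lgt0// normr_gt0.
have /choice[u uP] n : exists x, [/\ M x, `|x| <= 1 & k - n.+1%:R^-1 < `|K x|].
  have n0 : (0 : R) < n.+1%:R^-1 by rewrite invr_gt0.
  by have [_ [x [Mx x1] <-] kx] := sup_adherent n0 E_sup; exists x.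
have [y [_ yP]] : closure (K @` [set x | `|x| <= 1]) `&`
    cluster ((K \o u) @ \oo) !=set0.
  apply: K_compact; exists 0 => // n _ /=.
  by apply: subset_closure; exists (u n) => //; have [] := uP n.
(* A selection from [u] along which [K] tends to the cluster point at rate 1/(j+1). *)
have /choice[z zP] j : exists x, [/\ M x, `|x| <= 1, k - j.+1%:R^-1 < `|K x| &
    `|y - K x| < j.+1%:R^-1].
  have j0 : (0 : R) < j.+1%:R^-1 by rewrite invr_gt0.
  have [||_ [[n /= jn <-]]] := yP [set K (u n) | n in [set n | (j <= n)%N]]
      (ball y j.+1%:R^-1).
  - by exists j => // n /= jn; exists n.
  - exact: nbhsx_ballx.
  rewrite -ball_normE /= => yn.
  exists (u n); have [Mu u1 ku] := uP n; split => //.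
  apply: le_lt_trans ku; rewrite lerB// lef_pV2 ?posrE//.
  by rewrite ler_nat ltnS.
have Kz : (K \o z) @ \oo --> y.
  by apply: cvg_norm_harmonic => n; have [] := zP n.
have KKz : (fun n => K (K (z n))) @ \oo --> K y.
  by apply: continuous_cvg => //; exact: K_cont.
(* By symmetry |K^2 z - k^2 z|^2 <= k^2 (k^2 - |K z|^2), and k^2 - |K z|^2 = (k - |K z|)(k + |K z|)
   <= 2k/(n+1); this is the origin of 2 k^3. *)
have near0 : (fun n => K (K (z n)) - k ^+ 2 *: z n) @ \oo --> (0 : H).
  have sq0 : (fun n => 2 * k ^+ 3 * n.+1%:R^-1) @ \oo --> (0 : R).
    rewrite -[X in _ --> X](mulr0 (2 * k ^+ 3)); apply: cvgMr.
    exact: cvg_harmonic.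
  apply/cvgrPdist_lt => e e0.
  have [N _ NP] := cvgr_lt _ sq0 _ (exprn_gt0 2 e0).
  exists N => // n Nn; rewrite sub0r normrN.
  rewrite -ltr_sqr ?nnegrE ?normr_ge0 ?(ltW e0)//.
  apply: le_lt_trans (NP n Nn).
  have [Mz z1 kz _] := zP n.
  rewrite (normB_sqr (K (K (z n)))) ipZr K_sym ip_norm normrZ exprMn.
  rewrite (ger0_norm (sqr_ge0 k)).
  have Kz1 : `|K (z n)| <= k by rewrite (le_trans (Kk _ Mz))// ler_piMr// ltW.
  have h1 : `|K (K (z n))| ^+ 2 <= k ^+ 2 * `|K (z n)| ^+ 2.
    rewrite -exprMn ler_sqr ?nnegrE ?mulr_ge0 ?(ltW k0)//.
    by apply: Kk; exact: MK.
  have h2 : (k ^+ 2) ^+ 2 * `|z n| ^+ 2 <= (k ^+ 2) ^+ 2.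
    by rewrite ler_piMr ?sqr_ge0// expr_le1.
  have h3 : k ^+ 2 * (k ^+ 2 - `|K (z n)| ^+ 2) <=
            k ^+ 2 * (2 * k * n.+1%:R^-1).
    rewrite ler_pM2l ?exprn_gt0// subr_sqr mulrC.
    apply: ler_pM; [by rewrite addr_ge0// ltW|by rewrite subr_ge0| |].
      by rewrite mulrDl mul1r lerD2l.
    by rewrite lerBlDr -lerBlDl ltW.
  move: h1 h2 h3; set b := n.+1%:R^-1; set a := `|K (z n)| ^+ 2.
  have -> : (k ^+ 2) ^+ 2 = k ^+ 4 by rewrite -exprM.
  have -> : k ^+ 2 * (2 * k * b) = 2 * k ^+ 3 * b by ring.
  have -> : k ^+ 2 * (k ^+ 2 - a) = k ^+ 4 - k ^+ 2 * a by ring.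
  move: (k ^+ 2 * a) (k ^+ 4 * _) => p q; lra.
pose x := (k ^+ 2)^-1 *: K y.
have k2 : k ^+ 2 != 0 by rewrite expf_neq0// gt_eqF.
have zx : z @ \oo --> x.
  have -> : z = fun n => (k ^+ 2)^-1 *:
      (K (K (z n)) - (K (K (z n)) - k ^+ 2 *: z n)).
    by apply/funext => n; rewrite subKr scalerA mulVf// scale1r.
  by apply: cvgZr; rewrite -[K y]subr0; exact: cvgB.
have Kzx : (K \o z) @ \oo --> K x by apply: continuous_cvg => //; exact: K_cont.
have yE : y = K x by apply: (cvg_unique _ Kz Kzx).
have KKx : K (K x) = k ^+ 2 *: x by rewrite -yE /x scalerA mulfV// scale1r.
clearbody x; have Mx : M x.
  by apply: (closed_cvg M M_closed _ x zx); apply: nearW => n; have [] := zP n.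
(* In the limit |K x| >= k, which keeps [x] away from zero. *)
have Kx : 0 < `|K x|.
  have : (fun n => k - n.+1%:R^-1) @ \oo --> k - 0.
    by apply: cvgB; [exact: cvg_cst|exact: cvg_harmonic].
  rewrite subr0 => kn; apply: lt_le_trans k0 _.
  apply: (ler_cvg_to kn (cvg_norm Kzx)); apply: nearW => n.
  by have [_ _ /ltW] := zP n.
(* Since (K - k)(K + k) x = 0, either (K + k) x is an eigenvector for k, or it vanishes and [x] is
   one for -k. *)
have [Kxx|Kxx] := eqVneq (K x + k *: x) 0; last first.
  exists k, (K x + k *: x); split => //; first by rewrite gt_eqF.
    by rewrite addrC; apply: M_lin => //; exact: MK.
  by rewrite linearD KKx linearZ scalerDr scalerA -expr2 addrC.
exists (- k), x; split => //; first by rewrite oppr_eq0 gt_eqF.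
  by apply: contraTneq Kx => ->; rewrite linear0 normr0 ltxx.
by rewrite scaleNr; apply/eqP; rewrite -addr_eq0 Kxx.
Qed.

End compact_symmetric.

(** * Unbounded self-adjoint operators *)

Section operator_theory.
Context {R : realType} {H : hilbertType R} (T : operator H).

Lemma domZ (a : R) u : dom T u -> dom T (a *: u).
Proof. by move=> Tu; rewrite -[_ *: _]addr0; apply: dom_lin => //; exact: dom0. Qed.

Lemma domD u v : dom T u -> dom T v -> dom T (u + v).
Proof. by move=> Tu Tv; rewrite -[u]scale1r; exact: dom_lin. Qed.

Lemma app0 : T 0 = 0.
Proof.
have := app_lin 1 (dom0 T) (dom0 T); rewrite !scale1r addr0 => /esym/eqP.
by rewrite -subr_eq0 addrK => /eqP.
Qed.

Lemma appZ (a : R) u : dom T u -> T (a *: u) = a *: T u.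
Proof.
by move=> Tu; rewrite -[a *: u]addr0 app_lin// ?app0 ?addr0//; exact: dom0.
Qed.

Lemma appD u v : dom T u -> dom T v -> T (u + v) = T u + T v.
Proof. by move=> Tu Tv; rewrite -[u]scale1r app_lin// !scale1r. Qed.

Lemma domB u v : dom T u -> dom T v -> dom T (u - v).
Proof. by move=> Tu Tv; rewrite -scaleN1r; apply: domD => //; exact: domZ. Qed.

Lemma appB u v : dom T u -> dom T v -> T (u - v) = T u - T v.
Proof.
move=> Tu Tv; rewrite -scaleN1r appD//; last exact: domZ.
by rewrite appZ// scaleN1r.
Qed.

Hypothesis T_sa : self_adjoint T.

Lemma sa_sym u v : dom T u -> dom T v -> ip (T u) v = ip u (T v) :> R.
Proof. by move=> Tu Tv; have [_ /(_ v (T v))[->]] := T_sa. Qed.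

(** The symmetry relation passes to the limit, and the graph of the adjoint, which it describes, is
    the graph of [T]. *)
Lemma sa_closed_graph {I : Type} {F : set_system I} {FF : ProperFilter F}
    (u : I -> H) x z : (forall i, dom T (u i)) ->
  u @ F --> x -> (T \o u) @ F --> z -> dom T x /\ T x = z.
Proof.
move=> Tu ux Tuz; have [_ /(_ x z) h] := T_sa; apply/h => y Ty.
have h1 : (ip (T y) (u i) : R) @[i --> F] --> (ip (T y) x : R).
  by apply: ip_cvg => //; exact: cvg_cst.
have h2 : (ip y (T (u i)) : R) @[i --> F] --> (ip y z : R).
  by apply: ip_cvg => //; exact: cvg_cst.
have h3 : (ip (T y) (u i) : R) @[i --> F] --> (ip y z : R).
  by under eq_fun do rewrite sa_sym//.
exact: (cvg_unique _ h1 h3).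
Qed.

End operator_theory.

(** * Eigenvectors of S and their totality *)

Section eigenvectors.
Context {R : realType} {H : hilbertType R} (S : operator H) (omega : R).
Hypothesis S_sa : self_adjoint S.

(** Not the spectrum but a half-line containing all eigenvalues of S, since A = S^2 is bounded below
    by [omega]. Bounds on [spec] are bounds uniform in the eigenvalue. *)
Definition spec (s : R) := 0 < s /\ omega <= s ^+ 2.

Definition eig (s : R) (e : H) := [/\ spec s, dom S e & S e = s *: e].

Lemma eigZ a s e : eig s e -> eig s (a *: e).
Proof.
by move=> [ss Se SeE]; split; [|exact: domZ|rewrite appZ// SeE !scalerA mulrC].
Qed.

Lemma eig_orth s t e f : eig s e -> eig t f -> s != t -> ip e f = 0 :> R.
Proof.
move=> [_ Se SeE] [_ Sf SfE] st; have := sa_sym S_sa Se Sf.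
rewrite SeE SfE ipZl ipZr => /eqP; rewrite -subr_eq0 -mulrBl mulf_eq0.
by rewrite subr_eq0 (negbTE st) => /eqP.
Qed.

End eigenvectors.

Section totality.
Context {R : realType} {H : hilbertType R}.
Variables (A S : operator H) (omega : R).
Local Notation eig := (eig S omega).
Hypothesis A_sa : self_adjoint A.
Hypothesis A_pos : positive_op A.
Hypothesis A_compact : compact_resolvent A.
Hypothesis omega_gt0 : 0 < omega.
Hypothesis A_coercive : forall u, dom A u -> omega * `|u| <= `|A u|.
Hypothesis S_sqrt : is_sqrt S A.

Lemma dom_sqrtE u : dom A u <-> dom S u /\ dom S (S u).
Proof. by have [_ _ -> _] := S_sqrt. Qed.

Lemma app_sqrtE u : dom A u -> A u = S (S u).
Proof. by move=> Au; have [_ _ _ ->] := S_sqrt. Qed.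

Let S_sa : self_adjoint S. Proof. by have [] := S_sqrt. Qed.

Lemma sqrt_inj u : dom S u -> S u = 0 -> u = 0.
Proof.
move=> Su Su0; have Au : dom A u.
  by apply/dom_sqrtE; split => //; rewrite Su0; exact: dom0.
have := A_coercive Au; rewrite app_sqrtE// Su0 app0 normr0 pmulr_rle0//.
by rewrite normr_le0 => /eqP.
Qed.

Lemma inv_op_sqrt u : dom S u -> inv_op S (S u) = u.
Proof.
move=> Su; rewrite /inv_op; case: xgetP => [v _ [Sv SvE]|]; last first.
  by move=> /(_ u); case.
apply/eqP; rewrite -subr_eq0; apply/eqP/sqrt_inj; first exact: domB.
by rewrite appB// SvE subrr.
Qed.

Lemma eig_A s e : eig s e -> dom A e /\ A e = s ^+ 2 *: e.
Proof.
move=> [_ Se SeE]; have Ae : dom A e.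
  by apply/dom_sqrtE; split; rewrite // SeE; exact: domZ.
by split; rewrite // app_sqrtE// SeE appZ// SeE scalerA.
Qed.

(** The vector e = S y + sqrt(nu) y satisfies S e = sqrt(nu) e because S^2 y = nu y. Positivity of S
    makes its scalar product with [y] at least sqrt(nu) |y|^2, so [y] is not orthogonal to every
    eigenvector of S. *)
Lemma eig_of_A (nu : R) y : dom A y -> y != 0 -> A y = nu *: y ->
  exists s e, eig s e /\ (ip y e : R) != 0.
Proof.
move=> Ay y0 AyE; have ny : 0 < `|y| by rewrite normr_gt0.
have nu0 : 0 <= nu.
  have := A_pos Ay; rewrite AyE ipZl ip_norm pmulr_lge0// exprn_gt0//.
have nuo : omega <= nu.
  by have := A_coercive Ay; rewrite AyE normrZ (ger0_norm nu0) ler_pM2r.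
have s0 : 0 < Num.sqrt nu by rewrite sqrtr_gt0 (lt_le_trans omega_gt0).
have [Sy SSy] := (dom_sqrtE y).1 Ay.
exists (Num.sqrt nu), (S y + Num.sqrt nu *: y); split.
  split; first by split; rewrite // sqr_sqrtr.
    by apply: domD => //; exact: domZ.
  rewrite appD// ?appZ//; last exact: domZ.
  by rewrite -app_sqrtE// AyE scalerDr scalerA -expr2 sqr_sqrtr// addrC.
rewrite ipDr ipZr ip_norm gt_eqF// ltr_wpDl//; last by rewrite mulr_gt0// exprn_gt0.
by have [_ + _ _] := S_sqrt; rewrite ipC; exact.
Qed.

(** The orthogonal complement [M] of all eigenvectors of S is closed and invariant under the
    resolvent. If it were not zero, it would contain an eigenvector of the injective operator [K],
    hence one of A, and [eig_of_A] forbids this. *)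
Lemma eig_total x : (forall s e, eig s e -> ip x e = 0 :> R) -> x = 0.
Proof.
have [lambda [K [[K_cont KA AK] K_compact]]] := A_compact.
pose M := [set x : H | forall s e, eig s e -> ip x e = 0 :> R].
move=> Mx; apply: contrapT => /eqP x0.
have K_sym u v : ip (K u) v = ip u (K v) :> R.
  have [[Au {2}<-] [Av {1}<-]] := (KA u, KA v).
  by rewrite ipBr ipBl ipZl ipZr sa_sym.
have M_lin (a : R) u v : M u -> M v -> M (a *: u + v).
  by move=> Mu Mv s e se; rewrite ipDl ipZl (Mu s)// (Mv s)// mulr0 addr0.
have M_closed : closed M.
  move=> u uM s e se.
  apply: contrapT => /eqP ue.
  have cont : (ip v e : R) @[v --> u] --> (ip u e : R).
    by apply: ip_cvg; [exact: cvg_id|exact: cvg_cst].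
  have nz : nbhs (ip u e : R) [set r : R | r != 0].
    by apply: open_nbhs_nbhs; split => //; exact: open_neq.
  have /uM[v [Mv /=]] := cont _ nz.
  by rewrite (Mv s)// eqxx.
have MK u : M u -> M (K u).
  move=> Mu s e se; have [Ae AeE] := eig_A se.
  have /= := AK _ Ae; rewrite AeE -scalerBl K_sym.
  (* If [s ^+ 2 = lambda], injectivity of A - lambda forces [e = 0]. *)
  have [->|sl] := eqVneq (s ^+ 2 - lambda) 0.
    by rewrite scale0r linear0 => <-; rewrite linear0 ip0r.
  rewrite linearZ => Ke; have -> : K e = (s ^+ 2 - lambda)^-1 *: e.
    by rewrite -[e in RHS]Ke scalerA mulVf// scale1r.
  by rewrite ipZr (Mu s)// mulr0.
have Kx : K x != 0.
  apply: contra x0 => /eqP Kx; have [_ <-] := KA x.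
  by rewrite Kx app0 scaler0 subrr.
have [k [y [k0 My y0 Ky]]] :=
  compact_symmetric_eigenvector K_cont K_compact K_sym M_lin M_closed MK Mx Kx.
have [Ay AyE] := KA (k^-1 *: y).
(* Inverting the resolvent: A y - lambda y = k^-1 y. *)
have Kky : K (k^-1 *: y) = y by rewrite linearZ /= Ky scalerA mulVf// scale1r.
rewrite Kky in Ay AyE.
have AyE' : A y = (k^-1 + lambda) *: y by rewrite scalerDl -[k^-1 *: y]AyE subrK.
have [s [e [se]]] := eig_of_A Ay y0 AyE'.
by rewrite (My s)// eqxx.
Qed.

End totality.

(** * Bounded functions of S *)

Section functional_calculus.
Context {R : realType} {H : hilbertType R} (S : operator H) (omega : R).
Local Notation eig := (eig S omega).
Local Notation spec := (spec omega).
Hypothesis S_sa : self_adjoint S.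
Hypothesis eig_total :
  forall x, (forall s e, eig s e -> ip x e = 0 :> R) -> x = 0.

Definition eigs (l : seq (R * H)) := forall p, p \in l -> eig p.1 p.2.

(** This is phi(S) applied to the vector [vsum (fun=> 1) l], which the list represents. Eigenvalues
    may repeat and the vectors are not orthonormalized. *)
Definition vsum (phi : R -> R) (l : seq (R * H)) : H :=
  \sum_(p <- l) phi p.1 *: p.2.

Lemma vsum_cons phi p l : vsum phi (p :: l) = phi p.1 *: p.2 + vsum phi l.
Proof. exact: big_cons. Qed.

Lemma eigs_cons p l : eigs (p :: l) -> eig p.1 p.2 /\ eigs l.
Proof.
by move=> pl; split=> [|q ql]; apply: pl; rewrite inE ?eqxx// ql orbT.
Qed.

Lemma eigs_dense x (e : R) : 0 < e ->
  exists2 l, eigs l & `|x - vsum (fun=> 1) l| < e.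
Proof.
pose M := [set x | exists2 l, eigs l & x = vsum (fun=> 1) l].
move=> e0; have [|||m [l ll ->]] := @dense_of_orth _ _ M _ _ _ x e e0.
- by exists [::] => //; rewrite /vsum big_nil.
- move=> a _ _ [k kk ->] [l ll ->].
  exists ([seq (p.1, a *: p.2) | p <- k] ++ l).
    move=> p; rewrite mem_cat => /orP[/mapP[q qk ->]|/ll//].
    by apply: eigZ; exact: (kk q).
  rewrite /vsum big_cat big_map/= scaler_sumr; congr (_ + _).
  by apply: eq_bigr => p _; rewrite !scale1r.
- move=> y yM; apply: eig_total => s f sf; apply: yM.
  exists [:: (s, f)]; first by move=> p; rewrite inE => /eqP ->.
  by rewrite /vsum big_seq1 scale1r.
by exists l.
Qed.

(** Eigenvectors for eigenvalues other than [s] are orthogonal to [e], so every surviving term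
    carries the factor [phi s]. *)
Lemma ip_vsum_eig phi l s e : eigs l -> eig s e ->
  ip (vsum phi l) e = phi s * ip (vsum (fun=> 1) l) e :> R.
Proof.
move=> ll se; rewrite /vsum !ip_suml mulr_sumr.
rewrite !big_seq; apply: eq_bigr => p /ll pl.
rewrite !ipZl mul1r; have [->//|ps] := eqVneq p.1 s.
by rewrite (eig_orth S_sa pl se ps) !mulr0.
Qed.

(* M^2 |x|^2 - |phi(S) x|^2 = |sqrt(M^2 - phi^2)(S) x|^2 *)
Lemma vsum_le phi (M : R) l : eigs l -> 0 <= M ->
  (forall s, spec s -> `|phi s| <= M) ->
  `|vsum phi l| <= M * `|vsum (fun=> 1) l|.
Proof.
move=> ll M0 phiM; pose psi s := Num.sqrt (M ^+ 2 - phi s ^+ 2).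
rewrite -ler_sqr ?nnegrE ?mulr_ge0// exprMn -subr_ge0.
suff -> : M ^+ 2 * `|vsum (fun=> 1) l| ^+ 2 - `|vsum phi l| ^+ 2 =
    `|vsum psi l| ^+ 2 by exact: sqr_ge0.
(* Only the second argument of each scalar product is expanded; [ip_vsum_eig] then treats the first,
   and the sums agree term by term although the eigenvectors need not be orthogonal to one
   another. *)
rewrite -!ip_norm {2 4 6}/vsum !ip_sumr mulr_sumr -sumrB.
rewrite !big_seq; apply: eq_bigr => p /ll pl.
rewrite !ipZr mul1r (ip_vsum_eig phi ll pl) (ip_vsum_eig psi ll pl).
have [ps _ _] := pl; rewrite !mulrA -expr2 -mulrBl -expr2 sqr_sqrtr//.
rewrite subr_ge0 -[phi _ ^+ 2]real_normK ?num_real//.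
by rewrite ler_sqr ?nnegrE ?phiM.
Qed.

Lemma eigs_seq (x : H) : exists l : nat -> seq (R * H), (forall n, eigs (l n)) /\
  vsum (fun=> 1) (l n) @[n --> \oo] --> x.
Proof.
have /choice[l lP] n : exists l, eigs l /\ `|x - vsum (fun=> 1) l| < n.+1%:R^-1.
  by have [|l] := @eigs_dense x (n.+1%:R^-1); [rewrite invr_gt0|exists l].
exists l; split => [n|]; first by have [] := lP n.
by apply: cvg_norm_harmonic => n; have [] := lP n.
Qed.

(* z = phi(S) x *)
Definition is_fc (phi : R -> R) (x z : H) :=
  forall s e, eig s e -> ip z e = phi s * ip x e :> R.

Definition fc phi x := xget 0 (is_fc phi x).

Lemma is_fc_uniq phi x y z : is_fc phi x y -> is_fc phi x z -> y = z.
Proof.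
move=> xy xz; apply/eqP; rewrite -subr_eq0; apply/eqP/eig_total => s e se.
by rewrite ipBl (xy s)// (xz s)// subrr.
Qed.

(** Approximate [x] by finite sums. Negating the vectors of one list and appending it to another
    makes a difference of sums a single sum, so [vsum_le] transfers the Cauchy property from the
    approximations to their images. *)
Lemma fc_exists phi M x : (forall s, spec s -> `|phi s| <= M) ->
  exists2 z, is_fc phi x z & `|z| <= `|M| * `|x|.
Proof.
move=> phiM'; have phiM s : spec s -> `|phi s| <= `|M|.
  by move=> /phiM' /le_trans; apply; exact: ler_norm.
have [l [ll lx]] := eigs_seq x.
pose u n := vsum phi (l n); pose v n := vsum (fun=> 1) (l n).
have ux n k : `|u n - u k| <= `|M| * `|v n - v k|.
  pose L := l n ++ [seq (p.1, - p.2) | p <- l k].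
  have LE f : vsum f (l n) - vsum f (l k) = vsum f L.
    rewrite /vsum big_cat big_map -sumrN/=; congr (_ + _).
    by apply: eq_bigr => p _; rewrite scalerN.
  rewrite /u /v !LE; apply: vsum_le => //.
  move=> p; rewrite mem_cat => /orP[/ll//|/mapP[q /ll qk ->]].
  by rewrite -scaleN1r; exact: eigZ.
have [z uz] : exists z : H, u @ \oo --> z.
  apply: (@cauchy_sqr_cvg R H u (fun n => 2 * M ^+ 2 * `|x - v n| ^+ 2)).
    rewrite -[X in _ --> X](mulr0 (2 * M ^+ 2)); apply: cvgMr.
    have h : `|x - v n| @[n --> \oo] --> (0 : R).
      rewrite -(@normr0 _ H) -(subrr x); apply: cvg_norm.
      by apply: cvgB => //; exact: cvg_cst.
    by rewrite -[X in _ --> X](mulr0 0); exact: (cvgM h h).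
  move=> n k; have := ux n k.
  rewrite -ler_sqr ?nnegrE ?mulr_ge0// exprMn real_normK ?num_real//.
  move=> /le_trans; apply; rewrite [leRHS](_ : _ =
    M ^+ 2 * (2 * (`|x - v n| ^+ 2 + `|x - v k| ^+ 2))); last by ring.
  apply: ler_wpM2l; first exact: sqr_ge0.
  have -> : v n - v k = (x - v k) - (x - v n) by rewrite opprB [RHS]addrC addrA subrK.
  have := sqr_ge0 `|(x - v k) + (x - v n)|.
  rewrite (normD_sqr (x - v k)) (normB_sqr (x - v k)).
  set w : R := ip _ _; lra.
exists z.
  move=> s e se; have h1 : (ip (u n) e : R) @[n --> \oo] --> (ip z e : R).
    by apply: ip_cvg => //; exact: cvg_cst.
  have h2 : (ip (u n) e : R) @[n --> \oo] --> (phi s * ip x e : R).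
    under eq_fun do rewrite (ip_vsum_eig phi (ll _) se).
    by apply: cvgMr; apply: ip_cvg => //; exact: cvg_cst.
  exact: (cvg_unique _ h1 h2).
have vx : `|M| * `|v n| @[n --> \oo] --> `|M| * `|x|.
  by apply: cvgMr; exact: cvg_norm.
by apply: (ler_cvg_to (cvg_norm uz) vx); apply: nearW => n; exact: vsum_le.
Qed.

Lemma fcP phi M x : (forall s, spec s -> `|phi s| <= M) -> is_fc phi x (fc phi x).
Proof.
move=> phiM; have [z xz _] := fc_exists x phiM; rewrite /fc.
by case: xgetP => [y _ //|/(_ z)].
Qed.

Lemma fc_le phi M x : (forall s, spec s -> `|phi s| <= M) ->
  `|fc phi x| <= `|M| * `|x|.
Proof.
move=> phiM; have [z xz] := fc_exists x phiM.
by rewrite (is_fc_uniq xz (fcP x phiM)).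
Qed.

Lemma is_fcE phi M x z : (forall s, spec s -> `|phi s| <= M) ->
  is_fc phi x z -> fc phi x = z.
Proof. by move=> phiM; apply: is_fc_uniq; exact: fcP phiM. Qed.

Lemma fc_vsum phi M l : (forall s, spec s -> `|phi s| <= M) -> eigs l ->
  fc phi (vsum (fun=> 1) l) = vsum phi l.
Proof.
by move=> phiM ll; apply: (is_fcE phiM) => s e se; exact: ip_vsum_eig.
Qed.

End functional_calculus.

(** * Limits, derivatives and domains in the functional calculus *)

Lemma dist_le_of_derive {R : realType} (f f' : R -> R) (M T a b : R) :
  (forall t : R, is_derive t (1 : R) f (f' t)) -> (forall t, `|t| <= T -> `|f' t| <= M) ->
  `|a| <= T -> `|b| <= T -> `|f b - f a| <= M * `|b - a|.
Proof.
move=> f'P f'M; wlog ab : a b / a <= b.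
  move=> wl aT bT; have [/wl|/ltW/wl] := leP a b; first exact.
  by move=> h; rewrite distrC [in leRHS]distrC; exact: h.
move=> aT bT; have cf : {within `[a, b], continuous f}.
  apply: continuous_subspaceT => t; apply/differentiable_continuous.
  by apply/derivable1_diffP; exact: ex_derive.
have [c cab ->] := MVT_segment ab (fun t _ => f'P t) cf.
rewrite normrM ler_wpM2r// f'M//; move: cab; rewrite in_itv/= => /andP[ac cb].
rewrite ler_norml (le_trans cb) ?(le_trans (ler_norm b))// andbT.
by rewrite (le_trans _ ac)//; move: aT; rewrite ler_norml => /andP[].
Qed.

Lemma is_derive_cvg {R : realType} {V : normedModType R} (f : R -> V) (t : R) df :
  h^-1 *: (f (h + t) - f t) @[h --> (0 : R)^'] --> df -> is_derive t (1 : R) f df.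
Proof.
move=> h; have {}h : h^-1 *: ((f \o shift t) (h *: 1) - f t) @[h --> (0 : R)^'] --> df.
  by under eq_fun do rewrite /= [_ *: 1]mulr1.
by split; [exact: cvgP h|exact: cvg_lim h].
Qed.

Section functional_calculus_limits.
Context {R : realType} {H : hilbertType R} (S : operator H) (omega : R).
Local Notation eig := (eig S omega).
Local Notation eigs := (eigs S omega).
Local Notation spec := (spec omega).
Local Notation fc := (fc S omega).
Hypothesis S_sa : self_adjoint S.
Hypothesis eig_total :
  forall x, (forall s e, eig s e -> ip x e = 0 :> R) -> x = 0.

Lemma fcB phi M x y : (forall s, spec s -> `|phi s| <= M) ->
  fc phi (x - y) = fc phi x - fc phi y.
Proof.
move=> phiM; apply: (is_fcE S_sa eig_total phiM) => s e se.
by rewrite !ipBl !(fcP S_sa eig_total _ phiM se) mulrBr.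
Qed.

(** This plays the part of dominated convergence. A finite sum close to [x] sees finitely many
    eigenvalues, where pointwise convergence suffices; the remainder is small uniformly in [i] by
    the bound [M]. *)
Lemma fc_cvg {I : Type} {F : set_system I} {FF : ProperFilter F}
    (phi : I -> R -> R) psi (M : R) x :
  (\forall i \near F, forall s, spec s -> `|phi i s| <= M) ->
  (forall s, spec s -> phi i s @[i --> F] --> psi s) ->
  fc (phi i) x @[i --> F] --> fc psi x.
Proof.
move=> phiM phipsi.
have psiM s : spec s -> `|psi s| <= M.
  move=> ss; apply: (closed_cvg _ (@closed_le R M) _ _ (cvg_norm (phipsi s ss))).
  by apply: filterS phiM => i; exact.
pose N := `|M| + 1; have N0 : 0 < N by rewrite ltr_pwDr.
apply/cvgrPdist_lt => e e0.
have e3N : 0 < e / 3 / N by rewrite !divr_gt0.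
have [l ll xl] := eigs_dense eig_total x e3N.
set v := vsum _ l in xl.
have lcvg : vsum (phi i) l @[i --> F] --> vsum psi l.
  elim: l ll {xl v} => [|p l IH] ll.
    by rewrite /vsum big_nil; under eq_fun do rewrite big_nil; exact: cvg_cst.
  have [[ps _ _] {}/IH IH] := eigs_cons ll.
  rewrite vsum_cons; under eq_fun do rewrite vsum_cons.
  by apply: cvgD => //; apply: cvgZl; exact: phipsi.
have small f : (forall s, spec s -> `|f s| <= M) -> `|fc f (x - v)| < e / 3.
  move=> fM; apply: le_lt_trans (fc_le S_sa eig_total _ fM) _.
  apply: (@le_lt_trans _ _ (N * `|x - v|)).
    by rewrite ler_wpM2r// lerDl.
  by rewrite mulrC -ltr_pdivlMr.
have e3 : 0 < e / 3 by rewrite divr_gt0.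
near=> i.
have phiiM s : spec s -> `|phi i s| <= M by move: s; near: i.
have -> : fc psi x - fc (phi i) x =
    fc psi (x - v) + (vsum psi l - vsum (phi i) l) - fc (phi i) (x - v).
  rewrite (fcB _ _ psiM) (fcB _ _ phiiM).
  rewrite (fc_vsum S_sa eig_total psiM ll) (fc_vsum S_sa eig_total phiiM ll).
  by rewrite opprB !subrKA.
apply: le_lt_trans (ler_normB _ _) _.
have := small _ phiiM; have := small _ psiM.
have := ler_normD (fc psi (x - v)) (vsum psi l - vsum (phi i) l).
have : `|vsum psi l - vsum (phi i) l| < e / 3.
  by near: i; exact: cvgr_dist_lt lcvg _ e3.
lra.
Unshelve. all: by end_near. Qed.

Definition loc_bounded (phi : R -> R -> R) := forall T : R, exists M : R,
  forall t s, `|t| <= T -> spec s -> `|phi t s| <= M.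

Lemma fc_continuous phi x : loc_bounded phi ->
  (forall s, spec s -> continuous (phi ^~ s)) ->
  continuous (fun t => fc (phi t) x).
Proof.
move=> phib phic t; have [M phiM] := phib (`|t| + 1).
apply: (@fc_cvg _ (nbhs t) _ _ _ M); last by move=> s ss; exact: phic.
near=> u => s ss; apply: phiM => //.
have ut : `|t - u| <= 1.
  near: u; apply: filterS (nbhsx_ballx t 1 ltr01) => v.
  by rewrite -ball_normE /= => /ltW.
by rewrite -[u](subKr t) (le_trans (ler_normB _ _))// lerD2l.
Unshelve. all: by end_near. Qed.

(** The difference quotient is again a function of S. The mean value inequality bounds it by a bound
    of [psi], uniformly in the eigenvalue, so [fc_cvg] applies. *)
Lemma fc_derive phi psi x (t : R) : loc_bounded phi -> loc_bounded psi ->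
  (forall (u s : R), spec s -> is_derive u (1 : R) (phi ^~ s) (psi u s)) ->
  is_derive t (1 : R) (fun u => fc (phi u) x) (fc (psi t) x).
Proof.
move=> phib psib phi'; apply: is_derive_cvg.
pose q h s := h^-1 * (phi (h + t) s - phi t s).
have qE h : h^-1 *: (fc (phi (h + t)) x - fc (phi t) x) = fc (q h) x.
  have [M phiM] := phib `|h + t|; have [N phiN] := phib `|t|.
  apply/esym/(is_fcE (M := `|h^-1| * (M + N)) S_sa eig_total).
    move=> s ss; rewrite normrM ler_wpM2l// (le_trans (ler_normB _ _))//.
    by rewrite lerD ?phiM ?phiN.
  move=> s e se; rewrite ipZl ipBl.
  rewrite (fcP S_sa eig_total _ (fun s => phiM _ s (lexx _)) se).
  by rewrite (fcP S_sa eig_total _ (fun s => phiN _ s (lexx _)) se) -mulrBl mulrA.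
under eq_fun do rewrite qE.
(* The extra 1 leaves room for increments with |h| <= 1. *)
have [M psiM] := psib (`|t| + 1).
apply: (@fc_cvg _ (0 : R)^' _ _ _ M).
  near=> h => s ss; rewrite /q normrM normfV.
  have h0 : h != 0 by near: h; exact: nbhs_dnbhs_neq.
  rewrite mulrC ler_pdivrMr ?normr_gt0//.
  have := @dist_le_of_derive _ (phi ^~ s) (psi ^~ s) M (`|t| + 1) t (h + t).
  rewrite addrK; apply => //.
  - by move=> u; exact: phi'.
  - by move=> u ut; exact: psiM.
  - by rewrite lerDl.
  - rewrite addrC (le_trans (ler_normD _ _))// lerD2l.
    near: h; apply: dnbhs0_le; exact: ltr01.
move=> s ss; have [dphi <-] := phi' t s ss.
move: dphi; rewrite /derivable/derive /q => /cvg_ex[l]; move=> h.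
rewrite (cvg_lim _ h)//; move: h.
by under eq_fun do rewrite /= [_ *: 1]mulr1.
Unshelve. all: by end_near. Qed.

(** On finite sums S multiplies the coefficient at [s] by [s]; both sides converge, and the graph of
    S is closed. *)
Lemma fc_dom phi M N x : (forall s, spec s -> `|phi s| <= M) ->
  (forall s, spec s -> `|s * phi s| <= N) ->
  dom S (fc phi x) /\ S (fc phi x) = fc (fun s => s * phi s) x.
Proof.
move=> phiM phiN; have [l [ll lx]] := eigs_seq eig_total x.
have vc f K : (forall s, spec s -> `|f s| <= K) ->
    vsum f (l n) @[n --> \oo] --> fc f x.
  move=> fK; under eq_fun do rewrite -(fc_vsum S_sa eig_total fK (ll _)).
  apply/cvgrPdist_lt => e e0; pose K' := `|K| + 1.
  have K0 : 0 < K' by rewrite ltr_pwDr.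
  have eK : 0 < e / K' by rewrite divr_gt0.
  near=> n; rewrite -(fcB _ _ fK).
  apply: le_lt_trans (fc_le S_sa eig_total _ fK) _.
  apply: (@le_lt_trans _ _ (K' * `|x - vsum (fun=> 1) (l n)|)).
    by rewrite ler_wpM2r// lerDl.
  rewrite mulrC -ltr_pdivlMr//.
  by near: n; exact: cvgr_dist_lt lx _ eK.
have Sv k : eigs k -> dom S (vsum phi k) /\
    S (vsum phi k) = vsum (fun s => s * phi s) k.
  elim: k => [_|p k IH pk].
    by rewrite /vsum !big_nil app0; split => //; exact: dom0.
  have [[_ Sp SpE] /IH[Sk SkE]] := eigs_cons pk.
  rewrite !vsum_cons -SkE; split.
    by apply: domD => //; exact: domZ.
  by rewrite appD ?appZ ?SpE ?scalerA 1?mulrC//; exact: domZ.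
apply: (sa_closed_graph S_sa (u := fun n => vsum phi (l n)) _ (vc _ _ phiM)).
  by move=> n; have [] := Sv _ (ll n).
have -> : S \o (fun n => vsum phi (l n)) = fun n => vsum (fun s => s * phi s) (l n).
  by apply/funext => n /=; have [] := Sv _ (ll n).
exact: vc phiN.
Unshelve. all: by end_near. Qed.

End functional_calculus_limits.

(** * Scalar oscillators: explicit solutions and bounds uniform in the frequency *)

Section real_derivatives.
Context {R : realType}.
Implicit Types (f g : R -> R) (t : R).

Lemma derive_id t : is_derive t (1 : R) (fun u => u) 1.
Proof. exact: is_derive_id. Qed.

Lemma derive_add f g t a b : is_derive t (1 : R) f a -> is_derive t (1 : R) g b ->
  is_derive t (1 : R) (fun u => f u + g u) (a + b).
Proof. by move=> fa gb; exact: is_deriveD. Qed.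

Lemma derive_mul f g t a b : is_derive t (1 : R) f a -> is_derive t (1 : R) g b ->
  is_derive t (1 : R) (fun u => f u * g u) (f t * b + g t * a).
Proof. by move=> fa gb; exact: is_deriveM. Qed.

Lemma derive_cmul k f t a : is_derive t (1 : R) f a ->
  is_derive t (1 : R) (fun u => k * f u) (k * a).
Proof. by move=> fa; exact: is_deriveZ. Qed.

Lemma derive_opp f t a : is_derive t (1 : R) f a ->
  is_derive t (1 : R) (fun u => - f u) (- a).
Proof. by move=> fa; exact: is_deriveN. Qed.

Lemma derive_scaled (f f' : R -> R) k t : (forall u : R, is_derive u (1 : R) f (f' u)) ->
  is_derive t (1 : R) (fun u => f (k * u)) (k * f' (k * t)).
Proof.
move=> f'P; have kd : is_derive t (1 : R) (fun u : R => k * u) k.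
  by rewrite -[X in is_derive _ _ _ X]mulr1; apply: derive_cmul; exact: is_derive_id.
by rewrite mulrC; exact: (@is_derive1_comp R f).
Qed.

Lemma derive_sin k t : is_derive t (1 : R) (fun u => sin (k * u)) (k * cos (k * t)).
Proof. by apply: derive_scaled => u; exact: is_derive_sin. Qed.

Lemma derive_cos k t : is_derive t (1 : R) (fun u => cos (k * u)) (- (k * sin (k * t))).
Proof.
by rewrite -mulrN; apply: (derive_scaled (f' := fun u => - sin u)).
Qed.

Lemma nonincreasing_of_derive (f f' : R -> R) (a b : R) : a <= b ->
  (forall t : R, is_derive t (1 : R) f (f' t)) ->
  (forall t, a <= t <= b -> f' t <= 0) -> f b <= f a.
Proof.
move=> ab f'P f'0; have cf : {within `[a, b], continuous f}.
  apply: continuous_subspaceT => t; apply/differentiable_continuous.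
  by apply/derivable1_diffP; exact: ex_derive.
have [c cab fE] := MVT_segment ab (fun t _ => f'P t) cf.
by rewrite -subr_le0 fE mulr_le0_ge0 ?subr_ge0// f'0.
Qed.

(** For positive times e^{-u} (E + c) is nonincreasing; negative times follow by reflection. *)
Lemma gronwall (E E' : R -> R) (c T t : R) :
  (forall u : R, is_derive u (1 : R) E (E' u)) ->
  (forall u, `|u| <= T -> `|E' u| <= E u + c) -> `|t| <= T ->
  E t + c <= expR `|t| * (E 0 + c).
Proof.
wlog t0 : E E' t / 0 <= t.
  move=> wl E'P E'c tT; have [t0|/ltW t0] := leP 0 t; first exact: (wl E E').
  have := wl (fun u => E (- u)) (fun u => - E' (- u)) (- t).
  rewrite opprK oppr0 normrN oppr_ge0; apply => //.
    move=> u; have := @derive_scaled E E' (-1) u E'P.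
    by under eq_fun do rewrite mulN1r; rewrite !mulN1r.
  by move=> u uT; rewrite normrN E'c// normrN.
move=> E'P E'c tT.
have := @nonincreasing_of_derive (fun u => expR (-1 * u) * (E u + c))
  (fun u => expR (-1 * u) * (E' u + 0) + (E u + c) * (-1 * expR (-1 * u))) 0 t t0.
rewrite mulr0 expR0 mul1r mulN1r expRN (ger0_norm t0) ler_pdivrMl ?expR_gt0//.
apply => [u|u /andP[u0 ut]].
  have Ec := derive_add (E'P u) (is_derive_cst c u (1 : R)).
  exact: (derive_mul (derive_scaled (-1) u (@is_derive_expR R)) Ec).
have -> : expR (-1 * u) * (E' u + 0) + (E u + c) * (-1 * expR (-1 * u)) =
  expR (-1 * u) * (E' u - (E u + c)) by ring.
rewrite pmulr_rle0 ?expR_gt0// subr_le0 (le_trans (ler_norm _))// E'c//.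
by rewrite ger0_norm// (le_trans ut)// (le_trans _ tT)// ler_norm.
Qed.

Definition forced_osc (g : R -> R) (s : R) (y z : R -> R) :=
  [/\ y 0 = 0, z 0 = 0, forall t : R, is_derive t (1 : R) y (z t) &
      forall t : R, is_derive t (1 : R) z (g t - s ^+ 2 * y t)].

(** At resonance the solution is t sin(mu t) / (2 mu). Off resonance the factor 1/(s^2 - mu^2) is
    unbounded as s approaches mu, so bounds uniform in [s] are taken from the energy and not from
    these formulas. *)
Lemma forced_osc_cos (mu : R) : 0 < mu -> forall s, 0 < s ->
  exists y z, forced_osc (fun t => cos (mu * t)) s y z.
Proof.
move=> mu0 s s0; have mun0 : mu != 0 by rewrite gt_eqF.
have [->|smu] := eqVneq s mu.
  exists (fun t => (2 * mu)^-1 * (t * sin (mu * t))).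
  exists (fun t => (2 * mu)^-1 * (sin (mu * t) + mu * (t * cos (mu * t)))).
  split; rewrite ?(mul0r, mulr0, sin0, addr0)// => t.
    apply: is_derive_eq (derive_cmul _ (derive_mul (derive_id t)
      (derive_sin mu t))) _.
    by field.
  apply: is_derive_eq (derive_cmul _ (derive_add (derive_sin mu t)
    (derive_cmul mu (derive_mul (derive_id t) (derive_cos mu t))))) _.
  by field.
have d0 : s ^+ 2 - mu ^+ 2 != 0.
  by rewrite subr_sqr mulf_neq0 ?subr_eq0// gt_eqF// addr_gt0.
exists (fun t => (s ^+ 2 - mu ^+ 2)^-1 * (cos (mu * t) + - cos (s * t))).
exists (fun t => (s ^+ 2 - mu ^+ 2)^-1 *
  (s * sin (s * t) + - (mu * sin (mu * t)))).
split; rewrite ?(mul0r, mulr0, sin0, cos0, addr0, oppr0, subrr)// => t.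
  apply: is_derive_eq (derive_cmul _ (derive_add (derive_cos mu t)
    (derive_opp (derive_cos s t)))) _.
  by field.
apply: is_derive_eq (derive_cmul _ (derive_add (derive_cmul s (derive_sin s t))
  (derive_opp (derive_cmul mu (derive_sin mu t))))) _.
by field.
Qed.

Lemma forced_osc_sin (mu : R) : 0 < mu -> forall s, 0 < s ->
  exists y z, forced_osc (fun t => sin (mu * t)) s y z.
Proof.
move=> mu0 s s0; have mun0 : mu != 0 by rewrite gt_eqF.
have [->|smu] := eqVneq s mu.
  exists (fun t => (2 * mu)^-1 * (mu^-1 * sin (mu * t) + - (t * cos (mu * t)))).
  exists (fun t => 2^-1 * (t * sin (mu * t))).
  split; rewrite ?(mul0r, mulr0, sin0, addr0, oppr0)// => t.
    apply: is_derive_eq (derive_cmul _ (derive_add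
      (derive_cmul _ (derive_sin mu t))
      (derive_opp (derive_mul (derive_id t) (derive_cos mu t))))) _.
    by field.
  apply: is_derive_eq (derive_cmul _ (derive_mul (derive_id t)
    (derive_sin mu t))) _.
  by field.
have sn0 : s != 0 by rewrite gt_eqF.
have d0 : s ^+ 2 - mu ^+ 2 != 0.
  by rewrite subr_sqr mulf_neq0 ?subr_eq0// gt_eqF// addr_gt0.
(* The coefficient mu/s of the free oscillation cancels the initial velocity. *)
exists (fun t => (s ^+ 2 - mu ^+ 2)^-1 *
  (sin (mu * t) + - (mu / s * sin (s * t)))).
exists (fun t => (s ^+ 2 - mu ^+ 2)^-1 *
  (mu * cos (mu * t) + - (mu * cos (s * t)))).
split; rewrite ?(mul0r, mulr0, sin0, cos0, addr0, oppr0, subrr)// => t.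
  apply: is_derive_eq (derive_cmul _ (derive_add (derive_sin mu t)
    (derive_opp (derive_cmul (mu / s) (derive_sin s t))))) _.
  by field; rewrite d0 sn0.
apply: is_derive_eq (derive_cmul _ (derive_add (derive_cmul mu (derive_cos mu t))
  (derive_opp (derive_cmul mu (derive_cos s t))))) _.
by field; rewrite d0 sn0.
Qed.

(* Gronwall applied to the energy s^2 z^2 + (g - s^2 y)^2 of the derived
   oscillator, whose derivative is 2 (g - s^2 y) g' *)
Lemma forced_osc_bound g g' s y z (mu T t : R) : forced_osc g s y z ->
  (forall t : R, is_derive t (1 : R) g (g' t)) ->
  (forall t, `|g' t| <= mu) -> `|t| <= T ->
  (s * z t) ^+ 2 + (g t - s ^+ 2 * y t) ^+ 2 <=
    expR T * (g 0 ^+ 2 + mu ^+ 2).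
Proof.
move=> [y0 z0 yz zq] gg' g'mu tT.
pose q u := g u + - (s ^+ 2 * y u).
pose E u := (s * z u) * (s * z u) + q u * q u.
have qd (u : R) : is_derive u (1 : R) q (g' u + - (s ^+ 2 * z u)).
  by apply: derive_add => //; apply: derive_opp; exact: derive_cmul.
have szd (u : R) : is_derive u (1 : R) (fun u => s * z u) (s * q u).
  exact: derive_cmul.
have Ed (u : R) : is_derive u (1 : R) E (2 * (q u * g' u)).
  apply: is_derive_eq (derive_add (derive_mul (szd u) (szd u))
    (derive_mul (qd u) (qd u))) _.
  by rewrite /q; ring.
have := @gronwall E _ (mu ^+ 2) T t Ed.
have -> : E 0 = g 0 ^+ 2 by rewrite /E /q y0 z0; ring.
move=> /(_ _ tT) h; rewrite (_ : _ + _ = E t); last by rewrite /E /q; ring.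
have mu2 : 0 <= mu ^+ 2 by exact: sqr_ge0.
have {}h : E t + mu ^+ 2 <= expR `|t| * (g 0 ^+ 2 + mu ^+ 2).
  (* The derivative obeys 2 |q g'| <= q^2 + g'^2 <= E + mu^2. *)
  apply: h => u _; rewrite ler_norml.
  have g'u : g' u ^+ 2 <= mu ^+ 2.
    by rewrite -[g' u ^+ 2]real_normK ?num_real// ler_sqr ?nnegrE// (le_trans _ (g'mu u)).
  have := sqr_ge0 (q u + g' u); have := sqr_ge0 (q u - g' u).
  have := sqr_ge0 (s * z u); rewrite /E.
  move: (s * z u) (q u) (g' u) g'u => a b d h1 h2 h3 h4.
  by apply/andP; split; move: h1 h2 h3 h4; nra.
apply: le_trans (le_trans _ h) _; first by rewrite lerDl.
by rewrite ler_wpM2r ?ler_expR// addr_ge0// sqr_ge0.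
Qed.

(** Deliberately crude: it avoids square roots where only some uniform bound matters. *)
Lemma norm_le_of_sqr (x N : R) : x ^+ 2 <= N -> `|x| <= N + 1.
Proof.
rewrite -[x ^+ 2]real_normK ?num_real// => h.
have := sqr_ge0 (`|x| - 1); have := normr_ge0 x; nra.
Qed.

End real_derivatives.

(** * Calculus for functions of time *)

Section vector_derivatives.
Context {R : realType}.
Local Notation mu := (@lebesgue_measure R).

Lemma is_derive_continuous {V : normedModType R} (f : R -> V) (t : R) df :
  is_derive t (1 : R) f df -> {for t, continuous f}.
Proof.
move=> fd; apply: differentiable_continuous.
by apply/derivable1_diffP; exact: ex_derive.
Qed.

Lemma is_derive_continuousT {V : normedModType R} (f f' : R -> V) :
  (forall t : R, is_derive t (1 : R) f (f' t)) -> continuous f.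
Proof. by move=> f'P t; exact: is_derive_continuous (f'P t). Qed.

Lemma cvg_is_derive {V : normedModType R} (f : R -> V) (t : R) df :
  is_derive t (1 : R) f df ->
  h^-1 *: (f (h + t) - f t) @[h --> (0 : R)^'] --> df.
Proof.
move=> [+ <-]; rewrite /derivable/derive => /cvg_ex[l h].
by rewrite (cvg_lim _ h)//; move: h; under eq_fun do rewrite /= [_ *: 1]mulr1.
Qed.

Lemma is_derive_ip {H : hilbertType R} (u v : R -> H) (t : R) du dv :
  is_derive t (1 : R) u du -> is_derive t (1 : R) v dv ->
  is_derive t (1 : R) (fun s => ip (u s) (v s) : R)
    ((ip du (v t) : R) + ip (u t) dv).
Proof.
move=> ud vd; apply: is_derive_cvg.
have vt : v (h + t) @[h --> (0 : R)^'] --> v t.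
  have sh : (h + t) @[h --> (0 : R)^'] --> t.
    have h0 : (h + t) @[h --> (0 : R)] --> 0 + t.
      by apply: cvgD; [exact: cvg_id|exact: cvg_cst].
    by rewrite add0r in h0; exact: cvg_within_filter h0.
  exact: cvg_comp sh (is_derive_continuous vd).
have quotE (h : R) : h^-1 *: ((ip (u (h + t)) (v (h + t)) : R) - ip (u t) (v t)) =
    (ip (h^-1 *: (u (h + t) - u t)) (v (h + t)) : R) +
    ip (u t) (h^-1 *: (v (h + t) - v t)).
  by rewrite ipZl ipZr -mulrDr ipBl ipBr addrA subrK.
under eq_fun do rewrite quotE.
apply: cvgD; apply: ip_cvg => //; [|exact: cvg_cst|]; exact: cvg_is_derive.
Qed.

Lemma Rintegral_derive (F F' : R -> R) (a b : R) : a <= b ->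
  (forall t : R, is_derive t (1 : R) F (F' t)) -> continuous F' ->
  \int[mu]_(t in `[a, b]) F' t = F b - F a.
Proof.
rewrite le_eqVlt => /predU1P[<- _ _|ab FF' F'c].
  by rewrite set_itv1 Rintegral_set1 subrr.
have Fc := is_derive_continuousT FF'.
rewrite /Rintegral (continuous_FTC2 (F := F) ab).
- by [].
- exact: continuous_subspaceT.
- split; first by move=> t _; exact: ex_derive.
  + by apply: cvg_at_right_filter; exact: Fc.
  + by apply: cvg_at_left_filter; exact: Fc.
- by move=> t _; rewrite derive1E derive_val.
Qed.

Lemma continuous_integrable (f : R -> R) (a b : R) : continuous f ->
  mu.-integrable `[a, b] (EFin \o f).
Proof.
move=> fc; apply: continuous_compact_integrable; first exact: segment_compact.
exact: continuous_subspaceT.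
Qed.

Lemma continuous_sqr_norm {V : normedModType R} (u : R -> V) :
  continuous u -> continuous (fun t => `|u t| ^+ 2).
Proof. by move=> uc t; apply: cvgM; apply: cvg_norm; exact: uc. Qed.

End vector_derivatives.

(** * Strong solutions and the energy estimate *)

Section strong_solutions.
Context {R : realType} {H : hilbertType R} (S : operator H).
Local Notation mu := (@lebesgue_measure R).
Hypothesis S_sa : self_adjoint S.

(** Living on the whole line removes one-sided derivatives at 0 and T. The fields are chosen to
    imply, for continuous [f], both [wave_solution] and [regular] on every [0,T]. *)
Record strong_solution (f : R -> H) (W : R -> H * H) : Prop := {
  strong_dom1 : forall t, dom S (W t).1;
  strong_dom2 : forall t, dom S (S (W t).1);
  strong_dom' : forall t, dom S (W t).2;
  strong_derive : forall t : R,
    is_derive t (1 : R) (fun s => (W s).1) (W t).2;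
  strong_deriveS : forall t : R,
    is_derive t (1 : R) (fun s => S (W s).1) (S (W t).2);
  strong_derive' : forall t : R,
    is_derive t (1 : R) (fun s => (W s).2) (f t - S (S (W t).1));
  strong_cont2 : continuous (fun t => S (S (W t).1));
  strong_cont' : continuous (fun t => S (W t).2) }.

Lemma strong_solution0 : strong_solution (fun=> 0) (fun=> (0, 0)).
Proof.
have S0 := dom0 S.
split => [t|t|t|t|t|t||] //=; rewrite ?app0 ?subr0//.
all: try exact: is_derive_cst.
all: by move=> t; exact: cvg_cst.
Qed.

Lemma strong_solutionD f g W V : strong_solution f W -> strong_solution g V ->
  strong_solution (fun t => f t + g t) (fun t => W t + V t).
Proof.
move=> [W1 W2 W' Wd WS Wd' Wc Wc'] [V1 V2 V' Vd VS Vd' Vc Vc'].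
have SD t : S (W t + V t).1 = S (W t).1 + S (V t).1 by exact: appD.
have SSD t : S (S (W t + V t).1) = S (S (W t).1) + S (S (V t).1).
  by rewrite SD appD.
have SD' t : S (W t + V t).2 = S (W t).2 + S (V t).2 by exact: appD.
split => [t|t|t|t|t|t||].
- exact: domD.
- by rewrite SD; exact: domD.
- exact: domD.
- exact: is_deriveD.
- by rewrite SD'; under eq_fun do rewrite SD; exact: is_deriveD.
- by rewrite SSD opprD addrACA; exact: is_deriveD.
- by rewrite (funext SSD) => t; apply: cvgD; [exact: Wc|exact: Vc].
- by rewrite (funext SD') => t; apply: cvgD; [exact: Wc'|exact: Vc'].
Qed.

Section one_solution.
Variables (f : R -> H) (W : R -> H * H).
Hypothesis fc : continuous f.
Hypothesis W_sol : strong_solution f W.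

Lemma strong_contS : continuous (fun t => S (W t).1).
Proof. exact: is_derive_continuousT (strong_deriveS W_sol). Qed.

Lemma strong_cont1 : continuous (fun t => (W t).1).
Proof. exact: is_derive_continuousT (strong_derive W_sol). Qed.

Lemma strong_contv : continuous (fun t => (W t).2).
Proof. exact: is_derive_continuousT (strong_derive' W_sol). Qed.

Lemma strong_wave_solution T : wave_solution S T f (W 0) W.
Proof.
split => [|//|phi phiS t].
  split; [|exact: continuous_subspaceT strong_contS
    |exact: continuous_subspaceT strong_cont1
    |exact: continuous_subspaceT strong_contv|].
    by move=> t _ [|//] _; exact: strong_dom1 W_sol t.
  by move=> t _; exact: strong_derive W_sol t.
have Sphi : dom S phi := phiS 0 isT.
rewrite in_itv/= => /andP[t0 _].
pose F' s : R := ip (f s) phi - ip (S (W s).1) (S phi).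
have Fd (s : R) : is_derive s (1 : R) (fun s => ip (W s).2 phi : R) (F' s).
  apply: is_derive_eq (is_derive_ip (strong_derive' W_sol s)
    (is_derive_cst phi s (1 : R))) _.
  rewrite ip0r addr0 ipBl; congr (_ - _).
  by rewrite (sa_sym S_sa)//; exact: strong_dom2 W_sol s.
have F'c : continuous F'.
  move=> s; apply: cvgB; apply: ip_cvg; try exact: cvg_cst.
    exact: fc.
  exact: strong_contS.
by rewrite (Rintegral_derive t0 Fd F'c) addrC subrK.
Qed.

Lemma strong_regular T : regular S T W.
Proof.
split.
- move=> t _ [|[|//]] _; [exact: strong_dom1 W_sol t|exact: strong_dom2 W_sol t].
- exact: continuous_subspaceT (strong_cont2 W_sol).
- move=> t _ [|//] _; exact: strong_dom' W_sol t.
- exact: continuous_subspaceT (strong_cont' W_sol).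
- by move=> t _; exact: strong_deriveS W_sol t.
Qed.

(** With E = |S w|^2 + |w'|^2, E' = 2 <w', f> <= E + |f|^2; integrating the derivative of e^{-s} E
    from zero data gives the factor e^T. *)
Lemma strong_energy T : W 0 = (0, 0) -> forall t, 0 <= t <= T ->
  `|S (W t).1| ^+ 2 + `|(W t).2| ^+ 2 <=
    expR T * \int[mu]_(s in `[0, T]) `|f s| ^+ 2.
Proof.
move=> W0 t /andP[t0 tT].
pose E s : R := ip (S (W s).1) (S (W s).1) + ip (W s).2 (W s).2.
pose E' s : R := 2 * ip (W s).2 (f s).
have Ed (s : R) : is_derive s (1 : R) E (E' s).
  apply: is_derive_eq.
    apply: (derive_add (is_derive_ip (strong_deriveS W_sol s) (strong_deriveS W_sol s))).
    exact: (is_derive_ip (strong_derive' W_sol s) (strong_derive' W_sol s)).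
  (* The terms in <S w', S w> and <w', S S w> cancel by symmetry of S. *)
  have Ssym := sa_sym S_sa (strong_dom' W_sol s) (strong_dom2 W_sol s).
  rewrite !ipBl !ipBr (ipC (S (W s).1)) Ssym (ipC (f s)) (ipC (S (S _))) /E'.
  ring.
pose F s := expR (-1 * s) * E s.
pose F' s := expR (-1 * s) * E' s + E s * (-1 * expR (-1 * s)).
have Fd (s : R) : is_derive s (1 : R) F (F' s).
  exact: (derive_mul (derive_scaled (-1) s (@is_derive_expR R)) (Ed s)).
have F'c : continuous F'.
  have ec : continuous (fun s : R => expR (-1 * s)).
    exact: is_derive_continuousT (fun s => derive_scaled (-1) s (@is_derive_expR R)).
  move=> s; apply: cvgD; apply: cvgM.
  - exact: ec.
  - by apply: cvgMr; apply: ip_cvg; [exact: strong_contv|exact: fc].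
  - exact: is_derive_continuous (Ed s).
  - by apply: cvgMr; exact: ec.
have fc2 := continuous_sqr_norm fc.
have : F t - F 0 <= \int[mu]_(s in `[0, t]) `|f s| ^+ 2.
  rewrite -(Rintegral_derive t0 Fd F'c).
  apply: le_Rintegral; [exact: measurable_itv|exact: continuous_integrable..|].
  move=> s /=; rewrite in_itv/= => /andP[s0 _].
  apply: (@le_trans _ _ (expR (-1 * s) * `|f s| ^+ 2)).
    have -> : F' s = expR (-1 * s) * (E' s - E s) by rewrite /F'; ring.
    rewrite ler_wpM2l ?expR_ge0// /E' /E !ip_norm.
    have := sqr_ge0 `|(W s).2 - f s|; rewrite normB_sqr.
    have := sqr_ge0 `|S (W s).1|; lra.
  by rewrite ler_piMl ?sqr_ge0// mulN1r expR_le1 oppr_le0.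
have -> : F 0 = 0 by rewrite /F /E W0 /= app0 !ip0l addr0 mulr0.
rewrite subr0 /F mulN1r expRN ler_pdivrMl ?expR_gt0// /E !ip_norm.
move=> /le_trans; apply.
have int_ge0 b : 0 <= \int[mu]_(s in `[0, b]) `|f s| ^+ 2.
  by apply: Rintegral_ge0 => s _; exact: sqr_ge0.
apply: ler_pM; rewrite ?expR_ge0 ?ler_expR//.
have fin b : (\int[mu]_(s in `[0%R, b]) (`|f s| ^+ 2)%:E)%E \is a fin_num.
  by apply: integrable_fin_num; [exact: measurable_itv|exact: continuous_integrable].
rewrite /Rintegral fine_le//.
apply: ge0_subset_integral; [exact: measurable_itv..| | |].
- exact: measurable_int (continuous_integrable 0 T fc2).
- by move=> s _; rewrite lee_fin sqr_ge0.
- by apply: subset_itvl; rewrite bnd_simp.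
Qed.

End one_solution.

End strong_solutions.

(** * Solutions with separated sources and coupled modes *)

Section forced_solutions.
Context {R : realType} {H : hilbertType R} (S : operator H) (omega : R).
Local Notation eig := (eig S omega).
Local Notation eigs := (eigs S omega).
Local Notation spec := (spec omega).
Local Notation fc := (fc S omega).
Hypothesis S_sa : self_adjoint S.
Hypothesis omega_gt0 : 0 < omega.
Hypothesis eig_total :
  forall x, (forall s e, eig s e -> ip x e = 0 :> R) -> x = 0.

(** The vector [h] is arbitrary in H, so all spatial regularity is gained from the bounded
    derivative of [g], through [forced_osc_bound]. *)
Lemma forced_strong_solution (g g' : R -> R) (mu : R) (h : H) :
  (forall t : R, is_derive t (1 : R) g (g' t)) ->
  (forall t, `|g t| <= 1) -> (forall t, `|g' t| <= mu) ->
  (forall s, spec s -> exists y z, forced_osc g s y z) ->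
  exists W, strong_solution S (fun t => g t *: h) W /\ W 0 = (0, 0).
Proof.
move=> gd g1 g'mu osc.
have /choice[yz yzP] s : exists yz : (R -> R) * (R -> R),
    spec s -> forced_osc g s yz.1 yz.2.
  have [/osc[y [z yz]]|ns] := pselect (spec s); first by exists (y, z).
  by exists (fun=> 0, fun=> 0).
pose y t s := (yz s).1 t; pose z t s := (yz s).2 t.
pose N T : R := expR T * (g 0 ^+ 2 + mu ^+ 2).
have bnd T t s : `|t| <= T -> spec s ->
    (s * z t s) ^+ 2 + (g t - s ^+ 2 * y t s) ^+ 2 <= N T.
  by move=> tT ss; exact: forced_osc_bound (yzP s ss) gd g'mu tT.
have szb : loc_bounded omega (fun t s => s * z t s).
  move=> T; exists (N T + 1) => t s tT ss; apply: norm_le_of_sqr.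
  by apply: le_trans (bnd T t s tT ss); rewrite lerDl sqr_ge0.
have qb : loc_bounded omega (fun t s => g t - s ^+ 2 * y t s).
  move=> T; exists (N T + 1) => t s tT ss; apply: norm_le_of_sqr.
  by apply: le_trans (bnd T t s tT ss); rewrite lerDr sqr_ge0.
(* The energy bounds g - s^2 y and |g| <= 1, so s^2 y is bounded: this is what places [W t] in
   D(A). *)
have ssyb : loc_bounded omega (fun t s => s * (s * y t s)).
  move=> T; have [M qM] := qb T; exists (1 + M) => t s tT ss.
  have -> : s * (s * y t s) = g t - (g t - s ^+ 2 * y t s) by ring.
  by apply: le_trans (ler_normB _ _) _; rewrite lerD// qM.
(* The bound descends from s^2 y to y by s^2 >= omega, then to s y by s <= 1 + s^2. *)
have yb : loc_bounded omega y.
  move=> T; have [M sM] := ssyb T; exists (omega^-1 * M) => t s tT ss.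
  rewrite ler_pdivlMl// (le_trans _ (sM t s tT ss))//.
  rewrite mulrA -expr2 normrM ler_wpM2r// ger0_norm ?sqr_ge0//.
  by case: ss.
have syb : loc_bounded omega (fun t s => s * y t s).
  move=> T; have [M sM] := ssyb T; have [K yK] := yb T.
  exists (K + M) => t s tT ss; have [s0 _] := ss.
  have := sM t s tT ss; have := yK t s tT ss.
  rewrite !normrM (ger0_norm (ltW s0)); have := normr_ge0 (y t s).
  have := sqr_ge0 (s - 1); move: `|y t s| => a; nra.
have zb : loc_bounded omega z.
  move=> T; exists (omega^-1 * N T + 1) => t s tT ss; apply: norm_le_of_sqr.
  rewrite ler_pdivlMl//; apply: le_trans (bnd T t s tT ss).
  apply: (@le_trans _ _ ((s * z t s) ^+ 2)); last by rewrite lerDl sqr_ge0.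
  by rewrite exprMn ler_wpM2r ?sqr_ge0//; case: ss.
have yd (t s : R) : spec s -> is_derive t (1 : R) (y ^~ s) (z t s).
  by move=> /yzP[].
have zd (t s : R) : spec s ->
    is_derive t (1 : R) (z ^~ s) (g t - s ^+ 2 * y t s).
  by move=> /yzP[].
have at_ phi : loc_bounded omega phi -> forall t, exists M,
    forall s, spec s -> `|phi t s| <= M.
  by move=> pb t; have [M pM] := pb `|t|; exists M => s; exact: pM.
pose W t := (fc (y t) h, fc (z t) h).
have SW t : dom S (W t).1 /\ S (W t).1 = fc (fun s => s * y t s) h.
  have [M yM] := at_ _ yb t; have [K yK] := at_ _ syb t.
  exact: (fc_dom S_sa eig_total h yM yK).
have SSW t : dom S (S (W t).1) /\
    S (S (W t).1) = fc (fun s => s * (s * y t s)) h.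
  have [_ ->] := SW t.
  have [M yM] := at_ _ ssyb t; have [K yK] := at_ _ syb t.
  exact: (fc_dom S_sa eig_total h yK yM).
have SW' t : dom S (W t).2 /\ S (W t).2 = fc (fun s => s * z t s) h.
  have [M yM] := at_ _ zb t; have [K yK] := at_ _ szb t.
  exact: (fc_dom S_sa eig_total h yM yK).
exists W; split; last first.
  congr pair; apply: (is_fcE (M := 0) S_sa eig_total).
  - by move=> s /yzP[y0 _ _ _]; rewrite /y y0 normr0.
  - by move=> s e [/yzP[y0 _ _ _] _ _]; rewrite ip0l /y y0 mul0r.
  - by move=> s /yzP[_ y0 _ _]; rewrite /z y0 normr0.
  - by move=> s e [/yzP[_ y0 _ _] _ _]; rewrite ip0l /z y0 mul0r.
split.
- by move=> t; have [] := SW t.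
- by move=> t; have [] := SSW t.
- by move=> t; have [] := SW' t.
- by move=> t; exact: (fc_derive S_sa eig_total h t yb zb yd).
- move=> t; have [_ ->] := SW' t.
  have -> : (fun s => S (W s).1) = fun s => fc (fun r => r * y s r) h.
    by apply/funext => s; have [] := SW s.
  apply: (fc_derive S_sa eig_total h t syb szb) => u s ss.
  exact: derive_cmul (yd u s ss).
- move=> t; have [_ ->] := SSW t.
  have -> : g t *: h - fc (fun s => s * (s * y t s)) h =
      fc (fun s => g t - s ^+ 2 * y t s) h.
    have [M qM] := at_ _ qb t; have [K sK] := at_ _ ssyb t.
    apply/esym/(is_fcE S_sa eig_total qM) => s e se.
    by rewrite ipBl ipZl (fcP S_sa eig_total _ sK se); ring.
  exact: (fc_derive S_sa eig_total h t zb qb zd).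
- have -> : (fun s => S (S (W s).1)) = fun s => fc (fun r => r * (r * y s r)) h.
    by apply/funext => s; have [] := SSW s.
  apply: (fc_continuous S_sa eig_total ssyb) => s ss.
  apply: (is_derive_continuousT (f' := fun t => s * (s * z t s))) => t.
  exact: derive_cmul (derive_cmul s (yd t s ss)).
- have -> : (fun s => S (W s).2) = fun s => fc (fun r => r * z s r) h.
    by apply/funext => s; have [] := SW' s.
  apply: (fc_continuous S_sa eig_total szb) => s ss.
  apply: (is_derive_continuousT (f' := fun t => s * (g t - s ^+ 2 * y t s))) => t.
  exact: derive_cmul (zd t s ss).
Qed.

Variable C : {linear H -> H}.

(** What cos(st) and sin(st) share: [c'] is the time derivative, and the bounds 1 and [s] are those
    that [forced_strong_solution] asks of a source factor. *)
Definition free_mode (c c' : R -> R -> R) := forall s, spec s ->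
  [/\ forall t : R, is_derive t (1 : R) (c ^~ s) (c' t s),
      forall t : R, is_derive t (1 : R) (c' ^~ s) (- (s ^+ 2 * c t s)),
      forall t, `|c t s| <= 1, forall t, `|c' t s| <= s &
      forall r, spec r -> exists y z, forced_osc (c ^~ s) r y z].

(** By superposition over the list: an eigenvector [e] for [s] adds the source [c t s] times the
    fixed vector [- C e], to which [forced_strong_solution] applies. *)
Lemma coupled_modes c c' (l : seq (R * H)) : free_mode c c' -> eigs l ->
  strong_solution S (fun=> 0) (fun t => (vsum (c t) l, vsum (c' t) l)) /\
  exists U, strong_solution S (fun t => - C (vsum (c t) l)) U /\ U 0 = (0, 0).
Proof.
move=> cP; elim: l => [_|[s e] l IH].
  have -> : (fun t => (vsum (c t) [::], vsum (c' t) [::])) =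
      (fun=> (0, 0)) :> (R -> H * H).
    by apply/funext => t; rewrite /vsum !big_nil.
  split; first exact: strong_solution0.
  exists (fun=> (0, 0)); split => //.
  under eq_fun do rewrite /vsum big_nil linear0 oppr0.
  exact: strong_solution0.
move=> /eigs_cons[/= se /IH{IH}[U1sol [U2 [U2sol U20]]]].
have [ss Se SeE] := se; have [cd c'd c1 c'1 osc] := cP s ss.
have zZ (f : R -> R) (t df : R) : is_derive t (1 : R) f df ->
    is_derive t (1 : R) (fun u => f u *: e) (df *: e).
  move=> fd; apply: is_derive_cvg.
  have quotE h : h^-1 *: (f (h + t) *: e - f t *: e) =
      (h^-1 *: (f (h + t) - f t)) *: e by rewrite -scalerBl scalerA.
  by under eq_fun do rewrite quotE; apply: cvgZl; exact: cvg_is_derive.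
split.
  have -> : (fun t => (vsum (c t) ((s, e) :: l), vsum (c' t) ((s, e) :: l))) =
      fun t => (c t s *: e, c' t s *: e) + (vsum (c t) l, vsum (c' t) l).
    by apply/funext => t; rewrite !vsum_cons.
  have -> : (fun=> 0) = (fun=> 0 + 0) :> (R -> H) by rewrite addr0.
  apply: strong_solutionD => //.
  have SZ (a : R) : S (a *: e) = (a * s) *: e by rewrite appZ// SeE scalerA.
  split => [t|t|t|t|t|t||] /=; rewrite ?SZ; try exact: domZ.
  - exact: zZ (cd t).
  - under eq_fun do rewrite SZ mulrC; rewrite mulrC.
    exact: zZ (derive_cmul s (cd t)).
  - rewrite sub0r -scaleNr -mulrA mulrC -expr2.
    exact: zZ (c'd t).
  - under eq_fun do rewrite !SZ.
    move=> t; apply: cvgZl; apply: cvgMl; apply: cvgMl.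
    exact: is_derive_continuous (cd t).
  - under eq_fun do rewrite !SZ.
    move=> t; apply: cvgZl; apply: cvgMl.
    exact: is_derive_continuous (c'd t).
have [V [Vsol V0]] := forced_strong_solution (- C e) cd c1 c'1 osc.
exists (fun t => V t + U2 t); split; last by rewrite V0 U20 addr0.
have -> : (fun t => - C (vsum (c t) ((s, e) :: l))) =
    fun t => c t s *: (- C e) + - C (vsum (c t) l).
  by apply/funext => t; rewrite vsum_cons linearD linearZ opprD scalerN.
exact: strong_solutionD.
Qed.

Lemma norm_cos_le1 (x : R) : `|cos x| <= 1.
Proof. by rewrite ler_norml cos_geN1 cos_le1. Qed.

Lemma norm_sin_le1 (x : R) : `|sin x| <= 1.
Proof. by rewrite ler_norml sin_geN1 sin_le1. Qed.

Lemma free_mode_cos :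
  free_mode (fun t s => cos (s * t)) (fun t s => - (s * sin (s * t))).
Proof.
move=> s [s0 _]; split => [t|t|t|t|r [r0 _]].
- exact: derive_cos.
- by rewrite expr2 -mulrA; apply: derive_opp; apply: derive_cmul; exact: derive_sin.
- exact: norm_cos_le1.
- by rewrite normrN normrM (ger0_norm (ltW s0)) ler_piMr ?norm_sin_le1 ?ltW.
- exact: forced_osc_cos.
Qed.

Lemma free_mode_sin :
  free_mode (fun t s => sin (s * t)) (fun t s => s * cos (s * t)).
Proof.
move=> s [s0 _]; split => [t|t|t|t|r [r0 _]].
- exact: derive_sin.
- by rewrite expr2 -mulrA -mulrN; apply: derive_cmul; exact: derive_cos.
- exact: norm_sin_le1.
- by rewrite normrM (ger0_norm (ltW s0)) ler_piMr ?norm_cos_le1 ?ltW.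
- exact: forced_osc_sin.
Qed.

End forced_solutions.

(** * Velocity of a finite-energy free wave *)

Section weak_solutions.
Context {R : realType} {H : hilbertType R} (S : operator H) (omega : R).
Local Notation eig := (eig S omega).
Local Notation fc := (fc S omega).
Local Notation mu := (@lebesgue_measure R).
Hypothesis S_sa : self_adjoint S.
Hypothesis eig_total :
  forall x, (forall s e, eig s e -> ip x e = 0 :> R) -> x = 0.

Lemma within_ip (D : set R) (u v : R -> H) : {within D, continuous u} ->
  {within D, continuous v} -> {within D, continuous (fun t => ip (u t) (v t) : R)}.
Proof. by move=> uc vc t; apply: ip_cvg; [exact: uc|exact: vc]. Qed.

Lemma within_mul (D : set R) (u v : R -> R) : {within D, continuous u} ->
  {within D, continuous v} -> {within D, continuous (fun t => u t * v t)}.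
Proof. by move=> uc vc t; apply: cvgM; [exact: uc|exact: vc]. Qed.

Lemma within_add (D : set R) (u v : R -> R) : {within D, continuous u} ->
  {within D, continuous v} -> {within D, continuous (fun t => u t + v t)}.
Proof. by move=> uc vc t; apply: cvgD; [exact: uc|exact: vc]. Qed.

Lemma within_opp (D : set R) (u : R -> R) : {within D, continuous u} ->
  {within D, continuous (fun t => - u t)}.
Proof. by move=> uc t; apply: cvgN; exact: uc. Qed.

Lemma constant_of_derive0 (f : R -> R) (T t : R) :
  {within `[0, T], continuous f} ->
  (forall s : R, s \in `]0, T[ -> is_derive s (1 : R) f 0) ->
  t \in `[0, T] -> f t = f 0.
Proof.
move=> fc f0; rewrite in_itv/= => /andP[t0 tT].
have [|s|c _] := @MVT_segment R f (fun=> 0) 0 t t0.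
- move=> s; rewrite in_itv/= => /andP[s0 st]; apply: f0.
  by rewrite in_itv/= s0 (lt_le_trans st).
- apply: (continuous_subspaceW _ fc); apply: subset_itvl.
  by rewrite bnd_simp.
by rewrite mul0r => /eqP; rewrite subr_eq0 => /eqP.
Qed.

(** Testing the weak equation against [e] gives a = s <w, e> and b = <w', e> with a' = s b and b' =
    - s a, a plane rotation. *)
Lemma free_wave_eig T p W s e : 0 < T -> wave_solution S T (fun=> 0) p W ->
  eig s e -> forall t, t \in `[0, T] ->
  ip (W t).2 e = cos (s * t) * ip p.2 e - sin (s * t) * ip (S p.1) e :> R.
Proof.
move=> T0 [[W1 Sc Wc W'c Wd] W0 Weq] [ss Se SeE] t tT.
have zero_in : (0 : R) \in `[0, T] by rewrite in_itv/= lexx ltW.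
have domW r : r \in `[0, T] -> dom S (W r).1 by move=> /W1/(_ 0 isT).
pose k r : R := ip (0 : H) e - ip (S (W r).1) (S e).
have kE r : r \in `[0, T] -> k r = - (s * (s * ip (W r).1 e)).
  by move=> rT; rewrite /k SeE ipZr (sa_sym S_sa (domW r rT) Se) SeE ipZr ip0l sub0r.
have kc : {within `[0, T], continuous k}.
  move=> r; apply: cvgB; first exact: cvg_cst.
  by apply: ip_cvg; [exact: Sc|exact: cvg_cst].
(* The integral form of <w', e> is used because the fundamental theorem of calculus differentiates
   it; the weak formulation gives no derivative of w' itself. *)
pose b r : R := ip p.2 e + \int[mu]_(x in `[0, r]) k x.
have bE r : r \in `[0, T] -> ip (W r).2 e = b r.
  by move=> rT; rewrite (Weq e) // => -[|//] _.
pose a r : R := s * ip (W r).1 e.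
have ac : {within `[0, T], continuous a}.
  move=> r; apply: cvgMr; apply: ip_cvg; [exact: Wc|exact: cvg_cst].
have bc : {within `[0, T], continuous b}.
  have h : {within `[0, T], continuous (fun r => ip (W r).2 e : R)}.
    by apply: within_ip => // r; exact: cvg_cst.
  by apply: subspace_eq_continuous h => r /set_mem/=; exact: bE.
have oc r : r \in `]0, T[ -> r \in `[0, T] by exact: subset_itv_oo_cc.
have ad (r : R) : r \in `]0, T[ -> is_derive r (1 : R) a (s * b r).
  move=> rT; apply: derive_cmul; rewrite -bE ?oc//.
  apply: is_derive_eq (is_derive_ip (Wd r rT) (is_derive_cst e r (1 : R))) _.
  by rewrite ip0r addr0.
have bd (r : R) : r \in `]0, T[ -> is_derive r (1 : R) b (- (s * a r)).
  move=> rT; rewrite -[X in is_derive _ _ _ X]add0r.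
  have kd : is_derive r (1 : R) (fun x => \int[mu]_(y in `[0, x]) k y) (- (s * a r)).
    rewrite -kE ?oc//; have := rT; rewrite in_itv/= => /andP[r0 rlT].
    have [||kd <-] := @continuous_FTC1_closed R k 0 r T rlT _ r0.
    - apply: continuous_compact_integrable => //; exact: segment_compact.
    - exact: within_continuous_continuous kc rT.
    - by rewrite derive1E; exact: DeriveDef.
  exact: derive_add (is_derive_cst _ r (1 : R)) kd.
have cosc : {within `[0, T], continuous (fun r => cos (s * r))}.
  apply: continuous_subspaceT => r.
  exact: is_derive_continuous (derive_cos s r).
have sinc : {within `[0, T], continuous (fun r => sin (s * r))}.
  apply: continuous_subspaceT => r.
  exact: is_derive_continuous (derive_sin s r).
(* Turning (a, b) back by the angle s r gives two constants of motion. *)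
have h1 := @constant_of_derive0
  (fun r => a r * cos (s * r) + - (b r * sin (s * r))) T t.
have h2 := @constant_of_derive0
  (fun r => a r * sin (s * r) + b r * cos (s * r)) T t.
have a0 : a 0 = ip (S p.1) e.
  by rewrite -W0 (sa_sym S_sa (domW 0 zero_in) Se) SeE ipZr.
have b0 : b 0 = ip p.2 e by rewrite -bE// W0.
rewrite bE// -a0 -b0.
have {h1} : a t * cos (s * t) + - (b t * sin (s * t)) = a 0.
  transitivity (a 0 * cos (s * 0) + - (b 0 * sin (s * 0))); last first.
    by rewrite mulr0 cos0 sin0 mulr0 mulr1 oppr0 addr0.
  apply: h1 => //.
    by apply: within_add; [|apply: within_opp]; apply: within_mul.
  move=> r rT.
  apply: is_derive_eq (derive_add (derive_mul (ad r rT) (derive_cos s r))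
    (derive_opp (derive_mul (bd r rT) (derive_sin s r)))) _.
  by ring.
have {h2} : a t * sin (s * t) + b t * cos (s * t) = b 0.
  transitivity (a 0 * sin (s * 0) + b 0 * cos (s * 0)); last first.
    by rewrite mulr0 cos0 sin0 mulr0 mulr1 add0r.
  apply: h2 => //.
    by apply: within_add; apply: within_mul.
  move=> r rT.
  apply: is_derive_eq (derive_add (derive_mul (ad r rT) (derive_sin s r))
    (derive_mul (bd r rT) (derive_cos s r))) _.
  by ring.
move=> <- <-; rewrite -[LHS]mulr1 -(cos2Dsin2 (s * t)); ring.
Qed.

(** The error is cos(tS) and sin(tS) applied to the errors on the data, hence bounded independently
    of [t]. The list [l0] approximates [- S p.1], which absorbs the sign of the sine term. *)
Lemma free_wave_approx T p W (l0 l1 : seq (R * H)) : 0 < T ->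
  eigs S omega l0 -> eigs S omega l1 ->
  wave_solution S T (fun=> 0) p W -> forall t, t \in `[0, T] ->
  `|(W t).2 - (vsum (fun s => cos (s * t)) l1 +
                vsum (fun s => sin (s * t)) l0)| <=
  `|p.2 - vsum (fun=> 1) l1| + `|- S p.1 - vsum (fun=> 1) l0|.
Proof.
move=> T0 l0e l1e Wsol t tT.
have cosb s : spec omega s -> `|cos (s * t)| <= 1 by move=> _; exact: norm_cos_le1.
have sinb s : spec omega s -> `|sin (s * t)| <= 1 by move=> _; exact: norm_sin_le1.
have -> : (W t).2 - (vsum (fun s => cos (s * t)) l1 +
    vsum (fun s => sin (s * t)) l0) =
    fc (fun s => cos (s * t)) (p.2 - vsum (fun=> 1) l1) +
    fc (fun s => sin (s * t)) (- S p.1 - vsum (fun=> 1) l0).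
  apply/eqP; rewrite -subr_eq0; apply/eqP/eig_total => s e se.
  rewrite ipBl ipBl (free_wave_eig T0 Wsol se tT) !ipDl.
  rewrite (fcP S_sa eig_total _ cosb se) (fcP S_sa eig_total _ sinb se).
  rewrite (ip_vsum_eig S_sa _ l1e se) (ip_vsum_eig S_sa _ l0e se).
  by rewrite !ipBl ipNl; ring.
apply: le_trans (ler_normD _ _) _; apply: lerD.
  by have := fc_le S_sa eig_total (p.2 - vsum (fun=> 1) l1) cosb; rewrite normr1 mul1r.
by have := fc_le S_sa eig_total (- S p.1 - vsum (fun=> 1) l0) sinb; rewrite normr1 mul1r.
Qed.

End weak_solutions.

(** * Continuous functions as elements of the Bochner space *)

Section square_integrable.
Context {R : realType} {V : completeNormedModType R}.
Local Notation mu := (@lebesgue_measure R).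

(** Left grid point of mesh 1/(n+1). The cut at the index of [T] keeps the range finite on the whole
    line, as [simple_fun] demands. *)
Definition grid_index (T : R) (n : nat) (t : R) : nat :=
  minn (Num.truncn (t * n.+1%:R)) (Num.truncn (T * n.+1%:R)).

(** Superlevel sets are empty, everything, or a half-line; a level set is a difference of two of
    them. *)
Lemma measurable_grid_index T n k : measurable [set t | grid_index T n t = k].
Proof.
have ge_meas m : measurable [set t | (m <= grid_index T n t)%N].
  have [mN|Nm] := leqP m (Num.truncn (T * n.+1%:R)); last first.
    rewrite (_ : [set t | _] = set0); first exact: measurable0.
    apply/seteqP; split => // t /=; rewrite /grid_index leq_min.
    by rewrite [X in _ && X]leqNgt Nm andbF.
  case: m mN => [_|m mN].
    by rewrite (_ : [set t | _] = setT); [exact: measurableT|apply/seteqP; split].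
  rewrite (_ : [set t | _] = `[m.+1%:R / n.+1%:R, +oo[%classic).
    exact: measurable_itv.
  by apply/seteqP; split => t /=;
    rewrite in_itv/= andbT /grid_index leq_min mN andbT ler_pdivrMr// truncn_gt_nat.
rewrite (_ : [set t | _] = [set t | (k <= grid_index T n t)%N] `\`
  [set t | (k.+1 <= grid_index T n t)%N]); first exact: measurableD.
apply/seteqP; split => t /=.
  by move=> ->; rewrite leqnn ltnn.
by move=> [kt /negP]; rewrite -leqNgt => tk; apply/eqP; rewrite eqn_leq tk kt.
Qed.

Lemma continuous_L2 (T : R) (g : R -> V) : continuous g -> L2 T g.
Proof.
move=> gc; split; last first.
  suff : sqnorm_int T g \is a fin_num by rewrite fin_numElt => /andP[].
  apply: integrable_fin_num; first exact: measurable_itv.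
  exact: (continuous_integrable 0 T (continuous_sqr_norm gc)).
exists (fun n t => g ((grid_index T n t)%:R / n.+1%:R)); split => [n|t].
  pose N := Num.truncn (T * n.+1%:R).
  pose val (k : nat) := g (k%:R / n.+1%:R).
  have idxN t : (grid_index T n t < N.+1)%N by rewrite ltnS geq_minr.
  split.
    apply: (@sub_finite_set _ _ (val @` `I_N.+1)).
      by move=> _ [t _ <-]; exists (grid_index T n t) => //; exact: idxN.
    exact: finite_image.
  move=> v; rewrite (_ : _ @^-1` _ =
      \bigcup_(k in [set k | val k = v]) [set t | grid_index T n t = k]).
    by apply: bigcup_measurable => k _; exact: measurable_grid_index.
  by apply/seteqP; split => t /=; [move=> tv; exists (grid_index T n t)|case=> k /= + ->].
rewrite in_itv/= => /andP[t0 tT].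
apply: continuous_cvg; first exact: gc.
apply/cvgrPdist_lt => e e0.
near=> n; have n0 : (0 : R) < n.+1%:R by [].
have -> : grid_index T n t = Num.truncn (t * n.+1%:R).
  by apply/minn_idPl; apply: le_truncn; rewrite ler_pM2r.
have tn0 : 0 <= t * n.+1%:R by rewrite mulr_ge0.
have /andP[lb ub] := truncn_itv tn0.
apply: (@le_lt_trans _ _ n.+1%:R^-1); last first.
  by near: n; exact: cvgr_lt _ (@cvg_harmonic R) _ e0.
rewrite ger0_norm ?subr_ge0 ?ler_pdivrMr// lerBlDr.
by rewrite -[X in _ <= X + _]mul1r -mulrDl ler_pdivlMr// addrC natr1 ltW.
Unshelve. all: by end_near. Qed.

Lemma sqnorm_int_continuous (T : R) (g : R -> V) :
  {within `[0, T], continuous (fun t => `|g t| ^+ 2)} ->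
  sqnorm_int T g = (\int[mu]_(t in `[0, T]) `|g t| ^+ 2)%:E.
Proof.
move=> gc; rewrite /sqnorm_int /Rintegral fineK//.
apply: integrable_fin_num; first exact: measurable_itv.
apply: continuous_compact_integrable => //; exact: segment_compact.
Qed.

End square_integrable.

(** * Observation of strong solutions *)

Section regular_observation.
Context {R : realType} {H G : hilbertType R} (S : operator H).
Hypothesis S_sa : self_adjoint S.
Variable B : H * H -> G.
Hypothesis B_bounded : bounded_H2H S B.

Lemma observed_continuous f W : strong_solution S f W ->
  continuous (fun t => B (W t)).
Proof.
move=> Wsol; have [B_lin [M BM]] := B_bounded.
have H2 t : Hk S 2 (W t).1.
  by move=> [|[|//]] _; [exact: (strong_dom1 Wsol)|exact: (strong_dom2 Wsol)].
have S1 t := strong_dom1 Wsol t; have S2 t := strong_dom2 Wsol t.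
move=> t; apply/cvgrPdist_lt => e e0.
pose q r := `|M| * (`|S (S (W t).1) - S (S (W r).1)| + `|(W t).2 - (W r).2|).
have Bq r : `|B (W t) - B (W r)| <= q r.
  have := B_lin (-1) (W r) (W t) (H2 r) (H2 t).
  rewrite !scaleN1r [- B _ + _]addrC => <-.
  apply: le_trans (BM _ _) _.
    move=> [|[|//]] _ /=; rewrite addrC; first exact: domB.
    by rewrite appB//; exact: domB.
  rewrite /= [- (W r).1 + _]addrC [- (W r).2 + _]addrC !appB//.
  by rewrite /q ler_wpM2r ?addr_ge0// ler_norm.
have qc : q r @[r --> t] --> q t.
  apply: cvgMr; apply: cvgD; apply: cvg_norm; apply: cvgB; try exact: cvg_cst.
    exact: (strong_cont2 Wsol).
  exact: (strong_contv Wsol).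
have q0 : q t = 0 by rewrite /q !subrr !normr0 addr0 mulr0.
rewrite q0 in qc; near=> r; apply: le_lt_trans (Bq r) _.
by near: r; exact: cvgr_lt _ qc _ e0.
Unshelve. all: by end_near. Qed.

(** The extension by continuity agrees with pointwise application of [B]: the constant sequence
    consists of regular solutions. *)
Lemma strong_observation T f W : continuous f -> strong_solution S f W ->
  observation S B T f (W 0) (fun t => B (W t)).
Proof.
move=> fc Wsol; split; first exact/continuous_L2/(observed_continuous Wsol).
exists (fun=> W 0), (fun=> f), (fun=> W).
have cst0 (V : completeNormedModType R) (g : R -> V) : cvgL2 T (fun=> g) g.
  rewrite /cvgL2 /sqnorm_int; under eq_fun do
    under eq_integral do rewrite /= subrr normr0 expr0n/=.
  by rewrite integral0; exact: cvg_cst.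
split; try exact: cvg_cst; try exact: cst0.
move=> n; split; first exact: continuous_L2.
  exact: strong_wave_solution.
exact: strong_regular Wsol T.
Qed.

End regular_observation.

Lemma linear_bound {R : realType} {V W : normedModType R} (L : {linear V -> W}) :
  continuous L -> exists2 c : R, 0 <= c & forall x, `|L x| <= c * `|x|.
Proof.
move=> /linear_bounded_continuous/linear_boundedP => h.
near +oo_R => c; exists c; first by near: c; exact: nbhs_pinfty_ge.
by near: c.
Unshelve. all: by end_near. Qed.

(** * From observability of the coupled system to observation of the velocity by C21 *)

Section key_estimate.
Context {R : realType} {H G : hilbertType R}.
Variables (S : operator H) (omega : R) (B : H * H -> G) (C21 : {linear H -> H}).
Local Notation eig := (eig S omega).
Local Notation eigs := (eigs S omega).
Local Notation mu := (@lebesgue_measure R).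
Hypothesis S_sa : self_adjoint S.
Hypothesis omega_gt0 : 0 < omega.
Hypothesis eig_total :
  forall x, (forall s e, eig s e -> ip x e = 0 :> R) -> x = 0.
Hypothesis S_inv : forall u, dom S u -> inv_op S (S u) = u.
Hypothesis B_bounded : bounded_H2H S B.
Hypothesis C21_cont : continuous C21.
Variables (T C Cad : R).
Hypothesis T_gt0 : 0 < T.
Hypothesis C_gt0 : 0 < C.
Hypothesis Cad_gt0 : 0 < Cad.
Hypothesis B_admissible :
  forall (p : H * H) (f : R -> H), Hk S 1 p.1 -> L2 T f ->
  forall (W : R -> H * H) (y : R -> G),
    wave_solution S T f p W -> observation S B T f p y ->
    (sqnorm_int T y <=
     Cad%:E * ((energy S 1 W 0)%:E + (energy S 1 W T)%:E
             + \int[mu]_(t in `[0%R, T]) (energy S 1 W t)%:E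
             + sqnorm_int T f))%E.
Hypothesis observability : forall p1 p2 : H * H,
  Hk S 1 p1.1 -> Hk S 1 p2.1 ->
  forall (U1 U2 : R -> H * H) (y : R -> G),
  wave_solution S T (fun=> 0) p1 U1 ->
  wave_solution S T (fun t => - C21 (U1 t).1) p2 U2 ->
  observation S B T (fun t => - C21 (U1 t).1) p2 y ->
  ((C * (energy S 0 U1 0 + energy S 1 U2 0))%:E <= sqnorm_int T y)%E.

(** It models the velocity of a free wave, [l1] standing for w^1 and [l0] for - S w^0. *)
Definition cosine_sum (l0 l1 : seq (R * H)) (t : R) : H :=
  vsum (fun s => cos (s * t)) l1 + vsum (fun s => sin (s * t)) l0.

(** In units of the integral of |C21 u1|^2, the energy of U2 at time T costs e^T/2, its time
    integral T e^T/2, and the source itself 1. *)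
Let K := expR T * (1 + T) / 2 + 1.

Lemma cosine_sum_observed (l0 l1 : seq (R * H)) : eigs l0 -> eigs l1 ->
  continuous (cosine_sum l0 l1) /\
  C * (2^-1 * (`|vsum (fun=> 1) l1| ^+ 2 + `|vsum (fun=> 1) l0| ^+ 2)) <=
  Cad * K * \int[mu]_(t in `[0, T]) `|C21 (cosine_sum l0 l1 t)| ^+ 2.
Proof.
move=> l0e l1e.
(* The coupled solution is split into a cosine part carried by [l1] and a sine part carried by
   [l0]. *)
have [Uc [Vc [Vcsol Vc0]]] :=
  coupled_modes S_sa omega_gt0 eig_total C21 (@free_mode_cos R omega) l1e.
have [Us [Vs [Vssol Vs0]]] :=
  coupled_modes S_sa omega_gt0 eig_total C21 (@free_mode_sin R omega) l0e.
have U1sol := strong_solutionD Uc Us; rewrite addr0 in U1sol.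
have := strong_solutionD Vcsol Vssol.
set U2 := fun t => Vc t + Vs t.
set U1 := (X in strong_solution S _ X) in U1sol.
have U1E t : (U1 t).1 = cosine_sum l0 l1 t by [].
have -> : (fun t => - C21 (vsum (fun s => cos (s * t)) l1) +
    - C21 (vsum (fun s => sin (s * t)) l0)) = fun t => - C21 (U1 t).1.
  by apply/funext => t; rewrite U1E linearD opprD.
move=> U2sol.
have u1c : continuous (fun t => (U1 t).1) by exact: strong_cont1 U1sol.
split; first exact: u1c.
have fc : continuous (fun t => - C21 (U1 t).1).
  move=> t; apply: cvgN; apply: continuous_cvg; first exact: C21_cont.
  exact: u1c.
have U20 : U2 0 = (0, 0) by rewrite /U2 Vc0 Vs0 addr0.
have H1 f W : strong_solution S f W -> Hk S 1 (W 0).1.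
  by move=> Wsol [|//] _; exact: (strong_dom1 Wsol).
have zc : continuous (fun _ : R => 0 : H) by move=> t; exact: cvg_cst.
have y_obs := strong_observation S_sa B_bounded T fc U2sol.
have U1w := strong_wave_solution S_sa zc U1sol T.
have U2w := strong_wave_solution S_sa fc U2sol T.
have := observability (H1 _ _ U1sol) (H1 _ _ U2sol) U1w U2w y_obs.
have := B_admissible (H1 _ _ U2sol) (continuous_L2 T fc) U2w y_obs.
have E10 : energy S 1 U2 0 = 0.
  by rewrite /energy subrr U20 /= app0 normr0 expr0n addr0 mulr0.
(* At time 0 the velocity of [U1] is S applied to the vector of [l0], and the A^{-1/2} in e_0
   removes this S. *)
have E00 : energy S 0 U1 0 =
    2^-1 * (`|vsum (fun=> 1) l1| ^+ 2 + `|vsum (fun=> 1) l0| ^+ 2).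
  have vsum_ext (f g : R -> R) l : f =1 g -> vsum f l = vsum g l :> H.
    by move=> fg; apply: eq_bigr => p _; rewrite fg.
  have l0S : dom S (vsum (fun=> 1) l0) /\
      S (vsum (fun=> 1) l0) = vsum (fun s => s) l0.
    elim: (l0) l0e => [_|p l IH pl].
      by rewrite /vsum !big_nil app0; split => //; exact: dom0.
    have [[_ Sp SpE] /IH[Sl SlE]] := eigs_cons pl.
    rewrite !vsum_cons -SlE scale1r -SpE; split; first exact: domD.
    exact: appD.
  rewrite /energy.
  have -> : hpow S 0 (U1 0).1 = vsum (fun=> 1) l1.
    rewrite /= (vsum_ext _ (fun=> 1) l1) => [|s]; last by rewrite mulr0 cos0.
    rewrite (vsum_ext _ (fun=> 0) l0) => [|s]; last by rewrite mulr0 sin0.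
    by rewrite /vsum [X in _ + X]big1 ?addr0// => p _; rewrite scale0r.
  have -> : hpow S (0 - 1) (U1 0).2 = inv_op S (U1 0).2 by [].
  have -> : (U1 0).2 = S (vsum (fun=> 1) l0); last first.
    by rewrite S_inv; case: l0S.
  case: l0S => _ ->; rewrite /=.
  rewrite (vsum_ext _ (fun=> 0) l1) => [|s]; last by rewrite mulr0 sin0 mulr0 oppr0.
  rewrite (vsum_ext _ id l0) => [|s]; last by rewrite mulr0 cos0 mulr1.
  by rewrite /vsum [X in X + _]big1 ?add0r// => p _; rewrite scale0r.
rewrite E10 E00 addr0 add0e => adm obs.
have := le_trans obs adm; rewrite sqnorm_int_continuous; last first.
  exact: continuous_subspaceT (continuous_sqr_norm fc).
have -> : \int[mu]_(t in `[0, T]) `|- C21 (U1 t).1| ^+ 2 =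
    \int[mu]_(t in `[0, T]) `|C21 (cosine_sum l0 l1 t)| ^+ 2.
  by apply: eq_Rintegral => t _; rewrite normrN U1E.
have en := strong_energy S_sa fc U2sol U20 (T := T).
move: en; rewrite (_ : \int[mu]_(s in _) `|- C21 (U1 s).1| ^+ 2 =
    \int[mu]_(t in `[0, T]) `|C21 (cosine_sum l0 l1 t)| ^+ 2); last first.
  by apply: eq_Rintegral => t _; rewrite normrN U1E.
set F := \int[mu]_(t in `[0, T]) _ => en.
have Ec : continuous (fun t => energy S 1 U2 t).
  rewrite /energy subrr => t; apply: cvgMr; apply: cvgD; apply: continuous_sqr_norm.
    exact: strong_contS U2sol.
  exact: strong_contv U2sol.
have Ele t : 0 <= t <= T -> energy S 1 U2 t <= 2^-1 * (expR T * F).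
  by move=> tT; rewrite /energy subrr ler_pM2l ?invr_gt0//; exact: en.
have EI : (\int[mu]_(t in `[0%R, T]) (energy S 1 U2 t)%:E <=
    (2^-1 * (expR T * F) * T)%:E)%E.
  apply: (@le_trans _ _ (\int[mu]_(t in `[0%R, T]) (2^-1 * (expR T * F))%:E)%E).
    apply: ge0_le_integral; first exact: measurable_itv.
    - move=> t _; rewrite lee_fin /energy mulr_ge0 ?addr_ge0 ?sqr_ge0//.
    - exact: measurable_int (continuous_integrable 0 T Ec).
    - exact: measurable_cst.
    - by move=> t; rewrite /= in_itv/= => /Ele h; rewrite lee_fin.
  rewrite integral_cst/=; last exact: measurable_itv.
  by rewrite lebesgue_measure_itv/= lte_fin T_gt0 oppr0 adde0 EFinM.
move=> /le_trans h.
have -> : Cad * K * F =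
    Cad * (2^-1 * (expR T * F) + 2^-1 * (expR T * F) * T + F).
  by rewrite /K; field.
rewrite -lee_fin; apply: h; rewrite [leRHS]EFinM.
apply: lee_wpmul2l; first by rewrite lee_fin ltW.
rewrite [leRHS]EFinD; apply: leeD => //; rewrite [leRHS]EFinD.
apply: leeD => //; rewrite lee_fin; apply: Ele.
by rewrite lexx ltW.
Qed.

(** Density carries the estimate from finite sums to every weak solution; two uses of |x|^2 <=
    2|y|^2 + 2|x-y|^2, on the data and on the integrand, produce the factor 4. *)
Lemma velocity_observed p W :
  wave_solution S T (fun=> 0) p W ->
  {within `[0, T], continuous (fun t => `|C21 (W t).2| ^+ 2)} /\
  C * energy S 1 W 0 <=
  4 * (Cad * K) * \int[mu]_(t in `[0, T]) `|C21 (W t).2| ^+ 2.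
Proof.
move=> Wsol; have [[_ _ _ W'c _] W0 _] := Wsol.
have [c c0 Cc] := linear_bound C21_cont.
have Qc : {within `[0, T], continuous (fun t => `|C21 (W t).2| ^+ 2)}.
  move=> t; have h : `|C21 (W u).2| @[u --> nbhs (t : subspace `[0, T])] -->
      `|C21 (W t).2|.
    by apply: cvg_norm; apply: continuous_cvg; [exact: C21_cont|exact: W'c].
  exact: (cvgM h h).
split => //; set Q := \int[mu]_(t in _) _.
have K0 : 0 <= K by rewrite /K addr_ge0// divr_ge0// mulr_ge0 ?expR_ge0 ?addr_ge0 ?ltW.
(* For data errors below d the velocity error is at most 2d and its image by C21 at most 2cd. Hence
   8 c^2 d^2 T in the integral, doubled when the factor 1/2 of the energy is cleared; 2C comes from
   the energy of the data. *)
pose L := 16 * (Cad * K) * T * c ^+ 2 + 2 * C.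
have L0 : 0 <= L.
  rewrite /L addr_ge0// !mulr_ge0 ?sqr_ge0//; exact: ltW.
suff key d : 0 < d -> C * energy S 1 W 0 <= 4 * (Cad * K) * Q + L * d ^+ 2.
  apply/ler_addgt0Pr => e e0; pose d := Num.min 1 (e / (L + 1)).
  have L1 : 0 < L + 1 by rewrite ltr_wpDl.
  have d0 : 0 < d by rewrite lt_min ltr01 divr_gt0.
  apply: le_trans (key d d0) _; rewrite lerD2l.
  have d1 : d <= 1 by rewrite ge_min lexx.
  have dL : d * (L + 1) <= e by rewrite -ler_pdivlMr// ge_min lexx orbT.
  have d2 : d ^+ 2 <= d by rewrite expr2 ler_piMr// ltW.
  apply: le_trans dL; rewrite mulrC; apply: ler_pM => //; first exact: sqr_ge0.
  by rewrite lerDl.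
move=> d0.
have [l1 l1e x1] := eigs_dense eig_total p.2 d0.
have [l0 l0e x0] := eigs_dense eig_total (- S p.1) d0.
have [uc est] := cosine_sum_observed l0e l1e.
have close t : t \in `[0, T] -> `|(W t).2 - cosine_sum l0 l1 t| <= 2 * d.
  move=> tT; apply: le_trans (free_wave_approx S_sa eig_total T_gt0 l0e l1e Wsol tT) _.
  by rewrite mulrDl mul1r lerD// ltW.
have Cuc : continuous (fun t => `|C21 (cosine_sum l0 l1 t)| ^+ 2).
  apply: (continuous_sqr_norm (u := fun t => C21 (cosine_sum l0 l1 t))) => t.
  by apply: continuous_cvg; [exact: C21_cont|exact: uc].
have Fle : \int[mu]_(t in `[0, T]) `|C21 (cosine_sum l0 l1 t)| ^+ 2 <=
    2 * Q + 8 * c ^+ 2 * d ^+ 2 * T.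
  have Qi : mu.-integrable `[0, T] (EFin \o (fun t => `|C21 (W t).2| ^+ 2)).
    by apply: continuous_compact_integrable => //; exact: segment_compact.
  have ci : mu.-integrable `[0, T] (EFin \o (fun=> 8 * c ^+ 2 * d ^+ 2)).
    have kc : continuous (fun _ : R => 8 * c ^+ 2 * d ^+ 2).
      by move=> t; exact: cvg_cst.
    exact: (continuous_integrable 0 T kc).
  have Qc2 : {within `[0, T], continuous (fun t => 2 * `|C21 (W t).2| ^+ 2)}.
    by apply: within_mul => //; apply: continuous_subspaceT => t; exact: cvg_cst.
  have Qi2 : mu.-integrable `[0, T] (EFin \o (fun t => 2 * `|C21 (W t).2| ^+ 2)).
    apply: continuous_compact_integrable; first exact: segment_compact.
    exact: Qc2.
  rewrite /Q -RintegralZl//.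
  have -> : 8 * c ^+ 2 * d ^+ 2 * T = \int[mu]_(t in `[0, T]) (8 * c ^+ 2 * d ^+ 2).
    rewrite Rintegral_cst/=; last exact: measurable_itv.
    by rewrite lebesgue_measure_itv/= lte_fin T_gt0 oppr0 adde0.
  rewrite -RintegralD//.
  apply: le_Rintegral => //.
  - exact: continuous_integrable.
  - apply: continuous_compact_integrable; first exact: segment_compact.
    by apply: within_add => //; apply: continuous_subspaceT => t; exact: cvg_cst.
  move=> t tT; have {}tT : t \in `[0, T] by [].
  have := Cc ((W t).2 - cosine_sum l0 l1 t); rewrite linearB.
  move=> /le_trans/(_ (ler_wpM2l c0 (close t tT))).
  set a := C21 (W t).2; set b := C21 (cosine_sum _ _ _) => ab.
  have {}ab : `|a - b| ^+ 2 <= (c * (2 * d)) ^+ 2.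
    by rewrite ler_sqr ?nnegrE// !mulr_ge0// ltW.
  have := sqr_norm_le2 b a; rewrite (distrC b a); move: ab; rewrite !exprMn; lra.
have e1 : energy S 1 W 0 <=
    `|vsum (fun=> 1) l1| ^+ 2 + `|vsum (fun=> 1) l0| ^+ 2 + 2 * d ^+ 2.
  have sq (x y : H) : `|x - y| < d -> `|x| ^+ 2 <= 2 * `|y| ^+ 2 + 2 * d ^+ 2.
    move=> xy; apply: le_trans (sqr_norm_le2 x y) _.
    by rewrite lerD2l ler_pM2l// ler_sqr ?nnegrE ?(ltW d0)// ltW.
  have := sq _ _ x1; have := sq _ _ x0.
  rewrite normrN /energy subrr W0 /=; lra.
have CK : 0 <= Cad * K by rewrite mulr_ge0// ltW.
have := ler_wpM2l CK Fle; have := ler_wpM2l (ltW C_gt0) e1; rewrite /L.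
move: est; set X := \int[mu]_(t in _) _; lra.
Qed.

End key_estimate.

Theorem theorem2p8 (R : realType) (H G : hilbertType R)
  (A S : operator H) (omega beta : R) (B : H * H -> G) (C21 : {linear H -> H})
  (A_sa : self_adjoint A) (A_pos : positive_op A)
  (A_compact : compact_resolvent A)
  (omega_gt0 : 0 < omega)
  (A_coercive : forall u, dom A u -> omega * `|u| <= `|A u|)
  (S_sqrt : is_sqrt S A)
  (B_bounded : bounded_H2H S B)
  (B_admissible : forall T : R, 0 < T -> exists2 C : R, 0 < C &
    forall (p : H * H) (f : R -> H), Hk S 1 p.1 -> L2 T f ->
    forall (W : R -> H * H) (y : R -> G),
      wave_solution S T f p W -> observation S B T f p y ->
      (sqnorm_int T y <=
       C%:E * ((energy S 1 W 0)%:E + (energy S 1 W T)%:E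
               + \int[lebesgue_measure]_(t in `[0%R, T]) (energy S 1 W t)%:E
               + sqnorm_int T f))%E)
  (C21_continuous : continuous C21)
  (C21_adjoint : forall k : nat, (k <= 1)%N -> bounded_on_Hk S k (adjoint C21))
  (C21_norm : opnorm C21 = beta)
  (C21_coercive : forall w : H, `|C21 w| ^+ 2 <= beta * ip (C21 w) w)
  (a_or_b_fails :
    ~ (exists2 T0 : R, 0 < T0 & forall T : R, T0 < T ->
       exists2 C2 : R, 0 < C2 & forall p : H * H, Hk S 1 p.1 ->
       forall W : R -> H * H, wave_solution S T (fun=> 0) p W ->
         ((C2 * energy S 1 W 0)%:E <= sqnorm_int T (fun t => C21 (W t).2))%E)
    \/
    ~ (exists2 T0 : R, 0 < T0 & forall T : R, T0 < T ->
       exists2 C1 : R, 0 < C1 & forall p : H * H, Hk S 1 p.1 ->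
       forall (W : R -> H * H) (y : R -> G),
         wave_solution S T (fun=> 0) p W ->
         observation S B T (fun=> 0) p y ->
         ((C1 * energy S 1 W 0)%:E <= sqnorm_int T y)%E)) :
  ~ (exists2 T3 : R, 0 < T3 & forall T : R, T3 < T ->
     exists2 C : R, 0 < C & forall p1 p2 : H * H,
       Hk S 1 p1.1 -> Hk S 1 p2.1 ->
     forall (U1 U2 : R -> H * H) (y : R -> G),
       wave_solution S T (fun=> 0) p1 U1 ->
       wave_solution S T (fun t => - C21 (U1 t).1) p2 U2 ->
       observation S B T (fun t => - C21 (U1 t).1) p2 y ->
       ((C * (energy S 0 U1 0 + energy S 1 U2 0))%:E <= sqnorm_int T y)%E).
Proof.
have S_sa : self_adjoint S by have [] := S_sqrt.
have S_inv u := inv_op_sqrt (u := u) omega_gt0 A_coercive S_sqrt.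
have tot := eig_total A_sa A_pos A_compact omega_gt0 A_coercive S_sqrt.
(* Whichever property is assumed to fail, it is established with the same threshold [T3]. *)
move=> [T3 T3_gt0 obs]; case: a_or_b_fails; apply; exists T3 => // T T3T.
  have T_gt0 := lt_trans T3_gt0 T3T.
  have [C C_gt0 obsT] := obs T T3T.
  have [Cad Cad_gt0 adm] := B_admissible T T_gt0.
  have K_gt0 : 0 < 4 * (Cad * (expR T * (1 + T) / 2 + 1)).
    have h : 0 <= expR T * (1 + T) / 2.
      by rewrite divr_ge0// mulr_ge0 ?expR_ge0// addr_ge0// ltW.
    by rewrite !mulr_gt0// ltr_wpDl.
  exists (C / (4 * (Cad * (expR T * (1 + T) / 2 + 1)))); first exact: divr_gt0.
  move=> p _ W Wsol.
  have [Qc est] := velocity_observed S_sa omega_gt0 tot S_inv B_bounded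
    C21_continuous T_gt0 C_gt0 Cad_gt0 adm obsT Wsol.
  rewrite (sqnorm_int_continuous Qc) lee_fin mulrAC ler_pdivrMr//.
  by rewrite [leRHS]mulrC.
(* Property (b): with [U1 = 0] the source vanishes, [U2] is the given free wave, and the constant is
   unchanged. *)
have [C C_gt0 obsT] := obs T T3T; exists C => // p Hp W y Wsol yobs.
have zc : continuous (fun _ : R => 0 : H) by move=> t; exact: cvg_cst.
have zw := strong_wave_solution S_sa zc (strong_solution0 S) T.
have fE : (fun _ : R => - C21 (0 : H)) = fun=> 0.
  by apply/funext => t; rewrite linear0 oppr0.
have H0 : Hk S 1 (0 : H) by move=> [|//] _; exact: dom0.
have := obsT (0, 0) p H0 Hp (fun=> (0, 0)) W y zw.
rewrite /= fE => /(_ Wsol yobs).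
have -> : energy S 0 (fun=> (0, 0)) 0 = 0.
  have inv0 : inv_op S 0 = 0 by rewrite -{1}(app0 S) S_inv//; exact: dom0.
  rewrite /energy; have -> : hpow S (0 - 1) (0 : H) = inv_op S 0 by [].
  by rewrite inv0 /= normr0 expr0n addr0 mulr0.
by rewrite add0r.
Qed.
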